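(* For every $L>0$, $\alpha>1$ and $K>0$ there are constants $c_1,c_2,C_1>0$ depending only on $\alpha,K$ and $L$ such that the following holds. Let $X$ be a centered, strongly square integrable random variable with values in $\mathcal{H}$, with covariance operator $\Sigma$ having eigenvalues $\lambda_1\geq\lambda_2\geq\dots>0$ and orthonormal basis of eigenvectors $u_1,u_2,\dots$. Suppose that the Karhunen--Loève coefficients $\eta_j=\lambda_j^{-1/2}\langle X,u_j\rangle$, $j\geq 1$, are independent and satisfy $\sup_{j\geq 1}\sup_{q\geq 1}q^{-1/2}(\mathbb{E}|\eta_j|^q)^{1/q}\leq L$. Suppose moreover that $\lambda_j\leq Kj^{-\alpha}$ for all $j\geq 1$. Let $X_1,\dots,X_n$ be independent copies of $X$, and let $\hat P_{\leq d}$ be the empirical PCA projection of rank $d$. Then, for all natural numbers $1\leq d\leq c_1n$, with probability at least $1-\exp(-c_2n)$, $$R(\hat P_{\leq d})\leq C_1d^{1-\alpha}.$$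
   Context: $\mathcal{H}$ is a real (separable, infinite-dimensional) Hilbert space with inner product $\langle\cdot,\cdot\rangle$ and norm $\|\cdot\|$. $X$ is an $\mathcal{H}$-valued random variable, centered ($\mathbb{E}X=0$) and strongly square integrable ($\mathbb{E}\|X\|^2<\infty$). For $u,v,x\in\mathcal{H}$, $(u\otimes v)x=\langle v,x\rangle u$. The covariance operator $\Sigma=\mathbb{E}\,X\otimes X$ has positive summable eigenvalues $\lambda_1\geq\lambda_2\geq\dots>0$ (with multiplicity) and corresponding eigenvectors $u_1,u_2,\dots$ assumed to form an orthonormal basis of $\mathcal{H}$, so $\Sigma=\sum_{j\geq1}\lambda_j\,u_j\otimes u_j$. $\mathcal{P}_d$ is the class of orthogonal projections on $\mathcal{H}$ of rank $d$. The reconstruction error of an orthogonal projection $P$ is $R(P)=\mathbb{E}\|X-PX\|^2=\mathrm{tr}(\Sigma(I-P))$, the expectation being over $X$ for fixed $P$; $R(\hat P)$ for a data-dependent $\hat P$ is the random variable obtained by plugging $\hat P$ into $R$, i.e. $\mathrm{tr}(\Sigma(I-\hat P))$. Given independent copies $X_1,\dots,X_n$ of $X$ ($n\geq 1$), the sample covariance is $\hat\Sigma=n^{-1}\sum_{i=1}^nX_i\otimes X_i$, with eigenvalues $\hat\lambda_1\geq\hat\lambda_2\geq\dots\geq0$ and an orthonormal basis of eigenvectors $\hat u_1,\hat u_2,\dots$. The empirical PCA projection is $\hat P_{\leq d}=\sum_{j\leq d}\hat u_j\otimes\hat u_j$, a minimizer over $\mathcal{P}_d$ of the empirical reconstruction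 error $R_n(P)=n^{-1}\sum_{i=1}^n\|X_i-PX_i\|^2$. *)

(* Defs.v *)
From HB Require Import structures.
From mathcomp Require Import all_boot all_order all_algebra finmap.
From mathcomp Require Import all_classical all_reals all_analysis.

Set Implicit Arguments.
Unset Strict Implicit.
Unset Printing Implicit Defensive.

Import Order.TTheory GRing.Theory Num.Theory.
Import numFieldNormedType.Exports.

Local Open Scope classical_set_scope.
Local Open Scope ring_scope.

(* A real Hilbert space is a complete normed space [H] with a symmetric
   positive definite bilinear form [ip : {dot H for idfun}] inducing its norm.
   Sequences [x_1, x_2, ...] are indexed from 0: [x_(j+1)] is [x j]. *)
Definition induces_norm (R : realType) (H : completeNormedModType R)
    (ip : {dot H for idfun}) : Prop :=
  forall x : H, ip x x = `|x| ^+ 2.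

Definition borel (R : realType) (H : completeNormedModType R) :=
  g_sigma_algebraType (@open H).

Section Hilbert.
Context (R : realType) (H : completeNormedModType R) (ip : {dot H for idfun}).

Definition tensor (u v : H) : H -> H := fun x => ip v x *: u.

(* Having an orthonormal basis indexed by [nat] makes [H] separable and
   infinite-dimensional. *)
Definition orthonormal_basis (e : nat -> H) : Prop :=
  (forall i j, ip (e i) (e j) = (i == j)%:R) /\
  (forall x, series (fun j => tensor (e j) (e j) x) @ \oo --> x).

Definition spectral_decomposition (S : H -> H) (lam : nat -> R)
    (e : nat -> H) : Prop :=
  [/\ orthonormal_basis e,
      forall j, S (e j) = lam j *: e j,
      forall i j, (i <= j)%N -> lam j <= lam i &
      forall j, 0 <= lam j].

Definition projection_le (e : nat -> H) (d : nat) : H -> H :=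
  fun x => \sum_(j < d) tensor (e j) (e j) x.

End Hilbert.

Section Probability.
Context (dT : measure_display) (T : measurableType dT) (R : realType)
  (P : probability T R).

Definition mutually_independent (I : choiceType) (d' : measure_display)
    (T' : measurableType d') (Y : I -> T -> T') : Prop :=
  forall (J : {fset I}) (A : I -> set T'),
    (forall i, measurable (A i)) ->
    P (\bigcap_(i in [set` J]) (Y i @^-1` A i)) =
    (\prod_(i <- J) P (Y i @^-1` A i))%E.

Definition identically_distributed (d' : measure_display)
    (T' : measurableType d') (Y Z : {RV P >-> T'}) : Prop :=
  forall A : set T', measurable A -> distribution P Y A = distribution P Z A.

(* sup_(q >= 1) q^(-1/2) (E |Y|^q)^(1/q), over real q *)
Definition subgaussian_norm (Y : T -> R) : \bar R :=
  ereal_sup [set ((q `^ (- 2^-1))%:E * Lnorm P q%:E (EFin \o Y))%E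
            | q in [set q : R | 1 <= q]].

(* The event [A] has probability at least [p]; for a measurable [A] this is
   [p%:E <= P A]. An event defined through eigenvectors chosen separately at
   each sample point need not be measurable. *)
Definition probability_at_least (p : R) (A : set T) : Prop :=
  exists E : set T, [/\ measurable E, E `<=` A & (p%:E <= P E)%E].

Context (H : completeNormedModType R) (ip : {dot H for idfun}).

(* [m] is the expectation of the H-valued [Y], in the weak sense; it coincides
   with the Bochner integral when [Y] is measurable with integrable norm and
   [H] is separable. *)
Definition has_mean (Y : T -> H) (m : H) : Prop :=
  forall v, ('E_P[fun w => ip (Y w) v] = (ip m v)%:E)%E.

Definition square_integrable (Y : T -> H) : Prop :=
  ('E_P[fun w => (`|Y w| ^+ 2)%R] < +oo)%E.

Definition is_covariance (Y : T -> H) (Sigma : H -> H) : Prop :=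
  forall x, has_mean (fun w => tensor ip (Y w) (Y w) x) (Sigma x).

Definition sample_covariance (n : nat) (Ys : 'I_n -> T -> H) (w : T) : H -> H :=
  fun x => n%:R^-1 *: \sum_(i < n) tensor ip (Ys i w) (Ys i w) x.

Definition KL_coefficient (Y : T -> H) (lam : nat -> R) (u : nat -> H)
    (j : nat) : T -> R :=
  fun w => (Num.sqrt (lam j))^-1 * ip (Y w) (u j).

Definition reconstruction_error (Y : T -> H) (Q : H -> H) : \bar R :=
  ('E_P[fun w => (`|Y w - Q (Y w)| ^+ 2)%R])%E.

End Probability.

(* Main.v *)
Require Import Defs.
From HB Require Import structures.
From mathcomp Require Import all_boot all_order all_algebra finmap.
From mathcomp Require Import all_classical all_reals all_analysis.
From mathcomp Require Import measurable_realfun ring lra.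

Set Implicit Arguments.
Unset Strict Implicit.
Unset Printing Implicit Defensive.

Import Order.TTheory GRing.Theory Num.Theory.
Import numFieldNormedType.Exports.

Local Open Scope classical_set_scope.
Local Open Scope ring_scope.

(** Write [P] for the projection onto the first [d] eigenvectors of the covariance
and [Q] for the empirical projection of rank [d].  The risk of [P] is the tail sum
of the eigenvalues beyond [d], which the polynomial decay bounds by a multiple
[tau] of [d^(1 - alpha)]; the point is that [Q] is worse by a constant factor only.

Splitting a vector into its part in the range of [P] and the rest shows
[R(Q) <= 2 sum_(j < d) lam_j |u_j - Q u_j|^2 + 2 R(P)], so the error that [Q] makes
on the leading eigenvectors has to be controlled.  In the coordinates
[eta_j] the first [d] coefficients of [X] form a vector of independent, centered
sub-Gaussian variables of variance one.  If the empirical second moment of these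
whitened vectors is at least [1/8] in every direction of [R^d], the population
error on the leading part is at most [8] times its empirical version
([leading_error_le]).  The latter is controlled by the empirical errors of [Q] and
of [P], and the former of these two is the smaller one, because the top
eigenvectors of the sample covariance capture the most of the sample
([empirical_pca_optimal]).  So everything reduces to the empirical error of [P],
an average of independent copies of the tail [|X - P X|^2].

Three events, each failing with exponentially small probability, finish the proof.
The empirical tail is at most a multiple of [tau], by a Chernoff bound whose
exponential moment comes from convexity of the exponential ([tail_exp_le]).  The
same argument bounds the trace of the empirical second moment of the whitened
vectors ([trace_mgf_le]).  Finally the lower bound in every direction: for a single
direction, nonnegativity of the square makes finite fourth moments sufficient for
a Chernoff bound on the lower tail ([linear_form_lower_mgf]).  To pass to
all directions at once, a vector of length
comparable to [sqrt d] is rounded to an integer vector one coordinate at a time,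
each time up or down, whichever makes the quadratic form smaller.  The form
increases by at most a quarter of its trace ([round_vector]), and only integer
vectors of squared length [O(d)] occur, of which there are at most exponentially
many in [d] ([card_lattice_net]).  A union bound over them is affordable as soon as
[d] is a small multiple of [n]. *)

(** * Expectations of products of independent variables *)

Section IndependentProduct.
Context d (T : measurableType d) (R : realType) (P : probability T R).
Import HBNNSimple.

(** The functional form of the statement that [Y] is independent of the weight
[G]: both sides are monotone limits over simple functions, for which the
identity is the hypothesis on indicators. *)
Lemma integral_mul_factor d' (T' : measurableType d') (Y : T -> T')
    (G : T -> R) (c : \bar R) :
  measurable_fun setT Y -> measurable_fun setT G -> (forall w, 0 <= G w) ->
  c \is a fin_num -> (0 <= c)%E ->
  (forall A, measurable A ->
     (\int[P]_w (\1_A (Y w) * G w)%:E = P (Y @^-1` A) * c)%E) ->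
  forall f : T' -> R, measurable_fun setT f -> (forall y, 0 <= f y) ->
  (\int[P]_w (f (Y w) * G w)%:E = (\int[P]_w (f (Y w))%:E) * c)%E.
Proof.
move=> mY mG G0 cfin c0 hind f mf f0.
have mEf : measurable_fun setT (fun y => (f y)%:E) by exact/measurable_EFinP.
pose f_ := nnsfun_approx measurableT mEf.
have cvgf y : (f_ n y)%:E @[n --> \oo] --> (f y)%:E.
  by apply: (cvg_nnsfun_approx measurableT mEf) => // x _; rewrite lee_fin.
have mf_ n : measurable_fun setT (fun w => f_ n (Y w)).
  by apply: measurableT_comp.
have ndf y m n : (m <= n)%N -> f_ m y <= f_ n y.
  by move=> mn; exact/lefP/nd_nnsfun_approx.
have simple n : (\int[P]_w (f_ n (Y w) * G w)%:E =
                 (\int[P]_w (f_ n (Y w))%:E) * c)%E.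
  have mI k : measurable_fun setT (fun w => \1_(f_ n @^-1` [set k]) (Y w) : R).
    by apply: measurableT_comp => //; exact: measurable_indic.
  have mpre k : measurable (f_ n @^-1` [set k]) by exact: measurable_sfunP.
  have mpre' k : measurable (Y @^-1` (f_ n @^-1` [set k])).
    by rewrite -[X in measurable X]setTI; exact: mY.
  have range0 k : k \in range (f_ n) -> 0 <= k.
    by rewrite inE => -[y _ <-].
  transitivity (\sum_(k \in range (f_ n))
      \int[P]_w (`|k|%:E * (\1_(f_ n @^-1` [set k]) (Y w) * G w)%:E))%E.
    rewrite -ge0_integral_fsum//; last 2 first.
    - move=> k; apply: emeasurable_funM => //; apply/measurable_EFinP.
      exact: measurable_funM.
    - by move=> k w _; rewrite -EFinM lee_fin mulr_ge0// mulr_ge0.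
    apply: eq_integral => w _; rewrite fimfunE mulr_fsuml -fsumEFin//.
    apply: eq_fsbigr => k /range0 k0; rewrite -EFinM mulrA ger0_norm//.
  under eq_fsbigr.
    move=> k _; rewrite ge0_integralZl//; last 2 first.
    - by apply/measurable_EFinP; exact: measurable_funM.
    - by move=> w _; rewrite lee_fin mulr_ge0.
    rewrite hind// muleA; over.
  transitivity (\sum_(k \in range (f_ n))
      \int[P]_w (`|k|%:E * (\1_(f_ n @^-1` [set k]) (Y w))%:E) * c)%E.
    apply: eq_fsbigr => k _; congr (_ * _)%E.
    rewrite ge0_integralZl//; last by apply/measurable_EFinP.
    congr (_ * _)%E; rewrite -[X in P X]setIT -integral_indic//.
  rewrite -ge0_mule_fsuml; last first.
    by move=> k; apply: integral_ge0 => w _; rewrite -EFinM lee_fin mulr_ge0.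
  congr (_ * _)%E; rewrite -ge0_integral_fsum//; last first.
    by move=> k; apply: emeasurable_funM => //; exact/measurable_EFinP.
  apply: eq_integral => w _; rewrite fimfunE -fsumEFin//.
  by apply: eq_fsbigr => k /range0 k0; rewrite -EFinM ger0_norm.
have lim1 : (\int[P]_w (f_ n (Y w) * G w)%:E @[n --> \oo] -->
             \int[P]_w (f (Y w) * G w)%:E)%E.
  rewrite [X in _ --> X](_ : _ =
    (\int[P]_w limn (fun n => (f_ n (Y w) * G w)%:E))%E).
    apply: cvg_monotone_convergence => //.
    - by move=> n; apply/measurable_EFinP; exact: measurable_funM.
    - by move=> n w _; rewrite lee_fin mulr_ge0.
    - by move=> w _ m n mn; rewrite lee_fin ler_wpM2r// ndf.
  apply: eq_integral => w _; apply/esym/cvg_lim => //.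
  by under eq_fun do rewrite EFinM; rewrite EFinM; apply: cvgeZr.
have lim2 : (\int[P]_w (f_ n (Y w))%:E @[n --> \oo] -->
             \int[P]_w (f (Y w))%:E)%E.
  rewrite [X in _ --> X](_ : _ =
    (\int[P]_w limn (fun n => (f_ n (Y w))%:E))%E).
    apply: cvg_monotone_convergence => //.
    - by move=> n; apply/measurable_EFinP.
    - by move=> n w _; rewrite lee_fin.
    - by move=> w _ m n mn; rewrite lee_fin ndf.
  by apply: eq_integral => w _; apply/esym/cvg_lim.
move: lim1; rewrite (eq_cvg _ _ simple) => lim1.
exact: (cvg_unique _ lim1 (cvgeZr cfin lim2)).
Qed.

(** The definition of independence is the case of indicator functions;
[integral_mul_factor] replaces the indicators by general functions one index
at a time. *)
Lemma mutually_independent_expectation_prod (I : choiceType) d'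
    (T' : measurableType d') (Y : I -> T -> T') (f : I -> T' -> R) (s : seq I) :
  mutually_independent P Y -> (forall i, measurable_fun setT (Y i)) ->
  (forall i, measurable_fun setT (f i)) -> (forall i y, 0 <= f i y) ->
  (forall i, (\int[P]_w (f i (Y i w))%:E)%E \is a fin_num) -> uniq s ->
  (\int[P]_w (\prod_(i <- s) f i (Y i w))%:E =
   \prod_(i <- s) \int[P]_w (f i (Y i w))%:E)%E.
Proof.
move=> indY mY mf f0 ffin us.
have mfY i : measurable_fun setT (fun w => f i (Y i w)).
  by apply: measurableT_comp.
have mprod (A : I -> set T') t : (forall i, measurable (A i)) ->
    measurable_fun setT (fun w => \prod_(i <- t) \1_(A i) (Y i w) : R).
  move=> mA; apply: measurable_prod => i _.
  by apply: measurableT_comp => //; exact: measurable_indic.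
(* The second factor collects the indices at which functions have been traded
for indicators. *)
suff gen t (A : I -> set T') : uniq (s ++ t) -> (forall i, measurable (A i)) ->
    (\int[P]_w ((\prod_(i <- s) f i (Y i w)) *
        \prod_(i <- t) \1_(A i) (Y i w))%:E =
     (\prod_(i <- s) \int[P]_w (f i (Y i w))%:E) *
        \prod_(i <- t) P (Y i @^-1` A i))%E.
  have := gen [::] (fun=> setT); rewrite cats0 big_nil mule1 => <- //.
  by apply: eq_integral => w _; rewrite big_nil mulr1.
elim: s us t A => [_ t A ut mA|i s IH /= /andP[s_i us] t A /andP[st_i ust] mA].
  rewrite big_nil mul1e; under eq_integral do rewrite big_nil mul1r.
  rewrite (_ : (\prod_(i <- t) _)%E =
      (\prod_(i <- [fset j | j in t]%fset) P (Y i @^-1` A i))%E); last first.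
    apply: perm_big; rewrite uniq_perm// ?fset_uniq// => j.
    by rewrite !inE.
  rewrite -indY// -[X in P X]setIT -integral_indic//; last first.
    apply: fin_bigcap_measurable => // j _.
    by rewrite -[X in measurable X]setTI; exact: mY.
  apply: eq_integral => w _; congr (_%:E).
  have [ts|/allPn[j jt nj]] := boolP (all (fun j => w \in Y j @^-1` A j) t).
    rewrite big_seq big1 => [|j jt].
      rewrite indicE mem_set//= => j /=; rewrite !inE /= => jt.
      by have /allP/(_ _ jt) := ts; rewrite inE.
    by have /allP/(_ _ jt) := ts; rewrite indicE inE => /= Yj; rewrite mem_set.
  rewrite indicE memNset/=; last first.
    move=> /(_ j) /=; rewrite !inE => /(_ jt) Yj; move: nj.
    by rewrite notin_setE; apply.
  apply/eqP; rewrite prodf_seq_eq0; apply/hasP; exists j => //=.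
  by rewrite indicE memNset//; move: nj; rewrite notin_setE.
under eq_integral do rewrite big_cons -mulrA.
rewrite big_cons -muleA.
have mfs : measurable_fun setT (fun w => \prod_(j <- s) f j (Y j w)).
  by apply: measurable_prod => j _.
apply: (integral_mul_factor (mY i)) => //.
- by apply: measurable_funM => //; exact: mprod.
- by move=> w; rewrite mulr_ge0// prodr_ge0.
- rewrite fin_numM// prode_fin_num// => j _; rewrite fin_num_measure//.
  by rewrite -[X in measurable X]setTI; exact: mY.
- rewrite mule_ge0// prode_ge0// => j _; apply: integral_ge0 => w _.
  by rewrite lee_fin.
move=> B mB; pose A' j := if j == i then B else A j.
have itN : i \notin t by move: st_i; rewrite mem_cat negb_or => /andP[].
have eqt (h h' : I -> R) : (forall j, j != i -> h j = h' j) ->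
    \prod_(j <- t) h j = \prod_(j <- t) h' j.
  move=> hh; rewrite big_seq [RHS]big_seq; apply: eq_bigr => j jt.
  by apply: hh; apply: contraNneq itN => <-.
have uA' : uniq (s ++ i :: t).
  by rewrite uniq_catC/= uniq_catC ust mem_cat orbC -mem_cat st_i.
have mA' j : measurable (A' j) by rewrite /A'; case: ifP.
have /esym := IH us (i :: t) A' uA' mA'.
rewrite big_cons {1}/A' eqxx.
rewrite (_ : (\prod_(j <- t) P (Y j @^-1` A' j) =
              \prod_(j <- t) P (Y j @^-1` A j))%E); last first.
  rewrite big_seq [RHS]big_seq; apply: eq_bigr => j jt.
  by rewrite /A' ifN//; apply: contraNneq itN => <-.
rewrite muleCA => ->.
apply: eq_integral => w _; rewrite big_cons {1}/A' eqxx mulrCA.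
congr ((_ * (_ * _))%:E); apply: eqt => j ji.
by rewrite /A' (negbTE ji).
Qed.

End IndependentProduct.

(** * Real inequalities *)

Section RealInequalities.
Context (R : realType).
Implicit Types x y : R.

Lemma expR_ge_tangent x y : expR y * (1 + (x - y)) <= expR x.
Proof.
rewrite [leRHS](_ : _ = expR y * expR (x - y)); last first.
  by rewrite -expRD; congr expR; ring.
by rewrite ler_wpM2l ?expR_ge0// expR_ge1Dx.
Qed.

(** Jensen's inequality for the sub-probability weights [w], the missing mass
being placed at the origin; obtained by summing tangent inequalities at the
weighted mean. *)
Lemma expR_convex_sum (I : Type) (s : seq I) (w f : I -> R) :
  (forall i, 0 <= w i) -> \sum_(i <- s) w i <= 1 ->
  expR (\sum_(i <- s) w i * f i) <=
  1 + \sum_(i <- s) w i * (expR (f i) - 1).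
Proof.
move=> w0 w1; set m := \sum_(i <- s) _.
pose W := \sum_(i <- s) w i.
have le1 : \sum_(i <- s) w i * (expR m * (1 + (f i - m))) <=
           \sum_(i <- s) w i * expR (f i).
  by apply: ler_sum => i _; rewrite ler_wpM2l// expR_ge_tangent.
(* The tangent inequality at the origin, which carries the mass [1 - W]. *)
have le2 : (1 - W) * (expR m * (1 + (0 - m))) <= (1 - W) * 1.
  by rewrite ler_wpM2l ?subr_ge0// -[X in _ <= X]expR0 expR_ge_tangent.
have eq1 : \sum_(i <- s) w i * (expR m * (1 + (f i - m))) =
           expR m * (W * (1 - m) + m).
  rewrite [in RHS]/W [in RHS]mulr_suml {3}/m -big_split mulr_sumr/=.
  by apply: eq_bigr => i _; ring.
have eq2 : \sum_(i <- s) w i * (expR (f i) - 1) =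
           \sum_(i <- s) w i * expR (f i) - W.
  by rewrite /W -sumrB; apply: eq_bigr => i _; ring.
rewrite eq2; rewrite eq1 in le1; nra.
Qed.

Lemma expR_interpolate x (t : R) : 0 <= t -> t <= 1 ->
  expR (t * x) <= 1 + t * (expR x - 1).
Proof.
move=> t0 t1; have := @expR_convex_sum unit [:: tt] (fun=> t) (fun=> x).
by rewrite !big_seq1; apply.
Qed.

(** From [expR x = (expR (- x / 2))^-2] and the bound [1 - x / 2 <= expR (- x
/ 2)], which keeps the estimate valid for all negative [x]. *)
Lemma expR_le_quadratic x : x <= 1 -> expR x <= 1 + x + 2 * x ^+ 2.
Proof.
move=> x1; set z := expR (- x / 2).
have z1 : 1 + - x / 2 <= z by exact: expR_ge1Dx.
have zx : expR x * z ^+ 2 = 1.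
  by rewrite -expRM_natr -expRD (_ : _ + _ = 0) ?expR0//; field.
have z0 : 0 < z ^+ 2 by rewrite exprn_gt0// expR_gt0.
rewrite -(ler_pM2r z0) zx.
apply: (@le_trans _ _ ((1 + x + 2 * x ^+ 2) * (1 + - x / 2) ^+ 2)).
  suff : 0 <= x ^+ 2 * ((1 - x) * (5 - 2 * x)) by lra.
  by rewrite mulr_ge0 ?sqr_ge0// mulr_ge0; lra.
rewrite ler_wpM2l//; first nra.
by rewrite ler_sqr ?nnegrE ?expR_ge0//; lra.
Qed.

(** For a centered variable the linear term integrates to zero, so this bounds
a Laplace transform by a square-exponential moment. *)
Lemma expR_le_addsq x : expR x <= x + expR (2 * x ^+ 2).
Proof.
have [x1|x1] := leP x 1.
  apply: le_trans (expR_le_quadratic x1) _.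
  by have := expR_ge1Dx (2 * x ^+ 2); lra.
have : expR x <= expR (2 * x ^+ 2) by rewrite ler_expR; nra.
by lra.
Qed.

Lemma expRN_le_quadratic x : 0 <= x -> expR (- x) <= 1 - x + x ^+ 2.
Proof.
move=> x0; rewrite expRN -[leLHS]mul1r ler_pdivrMr ?expR_gt0//.
apply: (@le_trans _ _ ((1 - x + x ^+ 2) * (1 + x))).
  by have := exprn_ge0 3 x0; lra.
by rewrite ler_wpM2l ?expR_ge1Dx//; nra.
Qed.

(** Converts a bound on the Laplace transform at [1] and [-1] into one on the
fourth moment. *)
Lemma pow4_le_expR x : x ^+ 4 <= 2 ^+ 8 * (expR x + expR (- x)).
Proof.
have pos (y : R) : 0 <= y -> y ^+ 4 <= 2 ^+ 8 * expR y.
  move=> y0; have h := expR_ge1Dx (y / 4).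
  have -> : expR y = expR (y / 4) ^+ 4.
    by rewrite -expRM_natr; congr expR; field.
  have -> : 2 ^+ 8 * expR (y / 4) ^+ 4 = (4 * expR (y / 4)) ^+ 4 by ring.
  by apply: lerXn2r; rewrite ?nnegrE ?mulr_ge0 ?expR_ge0//; lra.
have e0 := expR_ge0 x; have eN0 := expR_ge0 (- x).
have [/pos|x0] := leP 0 x; first by lra.
have : (- x) ^+ 4 <= 2 ^+ 8 * expR (- x) by apply: pos; lra.
rewrite (_ : (- x) ^+ 4 = x ^+ 4); [lra|ring].
Qed.

(** Stirling's lower bound for the factorial; it makes the moments [(2 k
L^2)^k] summable against [1 / k!]. *)
Lemma pow_self_le_fact (k : nat) : k%:R ^+ k <= expR 1 ^+ k * k`!%:R :> R.
Proof.
elim: k => [|k IH]; first by rewrite !expr0 mul1r.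
rewrite factS natrM exprS [X in _ <= X]mulrCA.
have k0 : 0 <= k.+1%:R :> R by [].
rewrite ler_wpM2l//.
have [->|k_gt0] := posnP k; first by rewrite expr0 expr1 mulr1 -[leLHS]expR0 ler_expR.
have step : k.+1%:R <= expR (k%:R^-1) * k%:R :> R.
  have := expR_ge1Dx (k%:R^-1 : R).
  rewrite -(@ler_pM2r _ k%:R) ?ltr0n// mulrDl mul1r mulVf ?pnatr_eq0 -?lt0n//.
  by rewrite -natr1.
apply: (@le_trans _ _ ((expR (k%:R^-1) * k%:R) ^+ k)).
  by apply: lerXn2r; rewrite ?nnegrE// mulr_ge0 ?expR_ge0.
rewrite exprMn -(expRM_natr _ k%:R^-1) mulVf ?pnatr_eq0 -?lt0n// exprS -mulrA.
by rewrite ler_wpM2l ?expR_ge0.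
Qed.

(** The tangent inequality of the convex function [x^(1 - alpha)] at [j + 1];
it is Bernoulli's inequality after division by [(j + 1)^(1 - alpha)]. *)
Lemma powR_step_le (alpha : R) (j : nat) : 1 < alpha -> (0 < j)%N ->
  (alpha - 1) * j.+1%:R `^ (- alpha) <= j%:R `^ (1 - alpha) - j.+1%:R `^ (1 - alpha).
Proof.
move=> a1 j0; have j0R : 0 < j%:R :> R by rewrite ltr0n.
have j1R : 0 < j.+1%:R :> R by rewrite ltr0n.
set a : R := j.+1%:R in j1R *; set b : R := j%:R in j0R *.
have ab : a = b + 1 by rewrite /a -natr1.
have bern : 1 + (alpha - 1) / a <= (b / a) `^ (1 - alpha).
  rewrite /powR gt_eqF ?divr_gt0//.
  apply: le_trans (expR_ge1Dx _).
  have := @le_ln1Dx _ (- a^-1).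
  rewrite (_ : 1 + - a^-1 = b / a); last by rewrite ab; field; lra.
  have -> : -1 < - a^-1 by rewrite ltrN2 invf_lt1//; lra.
  move=> /(_ isT) lnle.
  have a1' : 1 - alpha <= 0 by lra.
  by rewrite lerD2l (le_trans _ (ler_wnM2l a1' lnle))// mulrN -mulNr opprB.
have eb : b `^ (1 - alpha) = a `^ (1 - alpha) * (b / a) `^ (1 - alpha).
  by rewrite -powRM ?divr_ge0 ?ltW// mulrC divfK ?gt_eqF.
have ea : a `^ (1 - alpha) = a * a `^ (- alpha).
  rewrite powRD; last by rewrite (gt_eqF j1R) implybT.
  by rewrite powRr1 ?ltW.
have a0 : 0 <= a `^ (1 - alpha) by exact: powR_ge0.
rewrite eb.
have := ler_wpM2l a0 bern.
rewrite mulrDr mulr1 [X in _ + X <= _](_ : _ = (alpha - 1) * a `^ (- alpha)).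
  by rewrite lerBrDl.
by rewrite ea mulrC mulrA divfK ?gt_eqF.
Qed.

Lemma sum_powR_tail_le (alpha : R) (d N : nat) : 1 < alpha -> (0 < d)%N ->
  \sum_(d <= j < N) j.+1%:R `^ (- alpha) <= d%:R `^ (1 - alpha) / (alpha - 1).
Proof.
move=> a1 d0; have a1' : 0 < alpha - 1 by rewrite subr_gt0.
rewrite ler_pdivlMr//.
have [Nd|dN] := leqP N d; first by rewrite big_geq// mul0r powR_ge0.
rewrite mulrC mulr_sumr.
apply: (@le_trans _ _ (\sum_(d <= j < N)
    (j%:R `^ (1 - alpha) - j.+1%:R `^ (1 - alpha)))).
  rewrite big_nat_cond [leRHS]big_nat_cond; apply: ler_sum => j.
  rewrite andbT => /andP[dj _]; apply: powR_step_le => //.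
  exact: leq_trans dj.
have telescope (f : nat -> R) : \sum_(d <= j < N) (f j - f j.+1) = f d - f N.
  elim: N dN => // N IH; rewrite ltnS leq_eqVlt => /orP[/eqP<-|dN].
    by rewrite big_nat1.
  by rewrite big_nat_recr/= ?IH// ?subrKA// ltnW.
by rewrite (telescope (fun j => j%:R `^ (1 - alpha))) lerBlDr lerDl powR_ge0.
Qed.

(** With a bound [2] on an exponential moment, this is what makes the
threshold [2] exponentially unlikely. *)
Lemma expRN2_double_le : expR (- 2) * 2 <= expR (- 1) :> R.
Proof.
rewrite (_ : -1 = -2 + 1 :> R); last by ring.
rewrite expRD ler_wpM2l ?expR_ge0//.
by have := expR_ge1Dx (1 : R); lra.
Qed.

End RealInequalities.

(** * Chernoff bounds for independent copies *)

Section Chernoff.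
Context d (T : measurableType d) (R : realType) (P : probability T R).

Lemma identically_distributed_integral d' (T' : measurableType d')
    (Y Z : {RV P >-> T'}) (f : T' -> \bar R) :
  identically_distributed Y Z -> measurable_fun setT f ->
  (forall y, 0 <= f y)%E ->
  (\int[P]_w f (Y w) = \int[P]_w f (Z w))%E.
Proof.
move=> YZ mf f0.
have := ge0_integral_distribution (P := P) Y mf f0 => /= <-.
have := ge0_integral_distribution (P := P) Z mf f0 => /= <-.
by apply: eq_measure_integral => A mA _; exact: YZ.
Qed.

Lemma measurable_sum_ge0 d' (T' : measurableType d') (n : nat)
    (Xs : 'I_n -> {RV P >-> T'}) (f : T' -> R) : measurable_fun setT f ->
  measurable [set w | (0 <= \sum_(i < n) f (Xs i w))%R].
Proof.
move=> mf; rewrite -[X in measurable X]setTI.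
rewrite (_ : [set w | _] = (fun w => \sum_(i < n) f (Xs i w)) @^-1` `[0, +oo[).
  by apply: measurable_sum => // i; exact: measurableT_comp.
by apply/seteqP; split => w /=; rewrite in_itv/= andbT.
Qed.

(** Markov's inequality for the exponential of the sum, whose expectation
factors. Thresholds and scalings are absorbed into [f]. *)
Lemma chernoff_iid d' (T' : measurableType d') (n : nat)
    (X : {RV P >-> T'}) (Xs : 'I_n -> {RV P >-> T'}) (f : T' -> R) (k : R) :
  mutually_independent P (fun i => Xs i : T -> T') ->
  (forall i, identically_distributed (Xs i) X) ->
  measurable_fun setT f ->
  (\int[P]_w (expR (f (X w)))%:E <= (expR (- k))%:E)%E ->
  (P [set w | (0 <= \sum_(i < n) f (Xs i w))%R] <= (expR (- k * n%:R))%:E)%E.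
Proof.
move=> indX distX mf Ef.
have mexpf : measurable_fun setT (fun y => expR (f y)).
  exact: measurableT_comp.
have mfX i : measurable_fun setT (fun w => f (Xs i w)).
  exact: measurableT_comp.
have msum : measurable_fun setT (fun w => \sum_(i < n) f (Xs i w)).
  exact: measurable_sum.
have EfX i : (\int[P]_w (expR (f (Xs i w)))%:E <= (expR (- k))%:E)%E.
  rewrite (identically_distributed_integral (f := fun y => (expR (f y))%:E)
    (distX i))//; exact/measurable_EFinP.
have mA : measurable [set w | (0 <= \sum_(i < n) f (Xs i w))%R].
  exact: measurable_sum_ge0.
set A := [set w | _] in mA *.
rewrite -[A]setIT -integral_indic//.
apply: (@le_trans _ _ (\int[P]_w (expR (\sum_(i < n) f (Xs i w)))%:E)%E).
  apply: ge0_le_integral => //.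
  - apply/measurable_EFinP; exact: measurable_indic.
  - by apply/measurable_EFinP; exact: measurableT_comp.
  - move=> w _; rewrite lee_fin indicE; have [wA|_] := boolP (w \in A).
      by rewrite -expR0 ler_expR; move: wA; rewrite inE.
    exact: expR_ge0.
under eq_integral do rewrite expR_sum.
have finE i : (\int[P]_w (expR (f (Xs i w)))%:E)%E \is a fin_num.
  rewrite ge0_fin_numE; first by apply: le_lt_trans (EfX i) (ltry _).
  by apply: integral_ge0 => w _; rewrite lee_fin expR_ge0.
rewrite (mutually_independent_expectation_prod (P := P)
  (Y := fun i => Xs i : T -> T') (f := fun _ y => expR (f y)) indX)//;
  last exact: index_enum_uniq.
apply: (@le_trans _ _ (\prod_(i < n) (expR (- k))%:E)%E).
  suff /andP[] : (0 <= \prod_(i < n) \int[P]_w (expR (f (Xs i w)))%:E <=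
             \prod_(i < n) (expR (- k))%:E)%E by [].
  apply: (big_ind2 (fun x y => 0 <= x <= y)%E) => [|x1 x2 y1 y2|i _].
  - by rewrite lexx lee01.
  - move=> /andP[x0 x12] /andP[y0 y12]; rewrite mule_ge0//=.
    exact: lee_pmul.
  - by rewrite EfX andbT; apply: integral_ge0 => w _; rewrite lee_fin expR_ge0.
by rewrite prodEFin lee_fin prodr_const card_ord expRM_natr.
Qed.

End Chernoff.

(** * Sub-Gaussian variables *)

Section SubGaussian.
Context d (T : measurableType d) (R : realType) (P : probability T R).

Lemma integral_scale_nonneg (k : R) (f : T -> R) : 0 <= k ->
  measurable_fun setT f -> (forall w, 0 <= f w) ->
  (\int[P]_w (k * f w)%:E = k%:E * \int[P]_w (f w)%:E)%E.
Proof.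
move=> k0 mf f0; under eq_integral do rewrite EFinM.
apply: ge0_integralZl_EFin => //; last exact/measurable_EFinP.
by move=> w _; rewrite lee_fin.
Qed.

Lemma integrable_nonneg_bounded (f : T -> R) (M : R) :
  measurable_fun setT f -> (forall w, 0 <= f w) ->
  (\int[P]_w (f w)%:E <= M%:E)%E -> P.-integrable setT (fun w => (f w)%:E).
Proof.
move=> mf f0 fM; apply/integrableP; split; first exact/measurable_EFinP.
under eq_integral do rewrite abse_EFin ger0_norm//.
exact: le_lt_trans fM (ltry _).
Qed.

Lemma le_integral_nonneg (f g : T -> R) :
  measurable_fun setT f -> measurable_fun setT g -> (forall w, 0 <= f w) ->
  (forall w, f w <= g w) -> (\int[P]_w (f w)%:E <= \int[P]_w (g w)%:E)%E.
Proof.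
move=> mf mg f0 fg; apply: ge0_le_integral => //.
- by move=> w _; rewrite lee_fin.
- exact/measurable_EFinP.
- exact/measurable_EFinP.
- by move=> w _; rewrite lee_fin.
Qed.

(** The sub-Gaussian norm at the exponent [2 k], raised to the power [2 k];
these are the moments in the expansion of the exponential of a square. *)
Lemma subgaussian_even_moment (Y : T -> R) (L : R) (k : nat) :
  (subgaussian_norm P Y <= L%:E)%E -> (0 < k)%N ->
  (\int[P]_w (Y w ^+ k.*2)%:E <= ((L ^+ 2 * k.*2%:R) ^+ k)%:E)%E.
Proof.
move=> YL k0; set q : R := k.*2%:R.
have q1 : 1 <= q by rewrite /q ler1n double_gt0.
have q0 : q != 0 by rewrite gt_eqF//; lra.
have q_ge0 : 0 <= q by lra.
have : ((q `^ (- 2^-1))%:E * Lnorm P q%:E (EFin \o Y) <= L%:E)%E.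
  by apply: le_trans YL; apply: ereal_sup_ubound; exists q.
set N := Lnorm P _ _ => NL.
have N0 : (0 <= N)%E by exact: Lnorm_ge0.
have p0 : 0 < q `^ (- 2^-1) by apply: powR_gt0; lra.
have L0 : 0 <= L.
  by rewrite -lee_fin; apply: le_trans NL; rewrite mule_ge0// lee_fin ltW.
have NE : (N <= (q `^ 2^-1 * L)%:E)%E.
  rewrite -(@lee_pmul2l _ (q `^ (- 2^-1))%:E)// (le_trans NL)//.
  rewrite -EFinM mulrA -powRD; last by rewrite (gt_eqF (lt_le_trans ltr01 q1)) implybT.
  by rewrite addNr powRr0 mul1r.
have := poweR_Lnorm P (EFin \o Y) q0; rewrite -/N => EN.
apply: (@le_trans _ _ (N `^ q)%E).
  rewrite EN le_eqVlt; apply/orP; left; apply/eqP; apply: eq_integral => w _ /=.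
  rewrite /q powR_mulrn// -normrX ger0_norm//.
  by rewrite -mul2n exprM exprn_ge0// sqr_ge0.
apply: (@le_trans _ _ ((q `^ 2^-1 * L)%:E `^ q)%E).
  apply: gt0_ler_poweR => //.
  - by rewrite in_itv/= N0 leey.
  - by rewrite in_itv/= lee_fin mulr_ge0 ?powR_ge0// leey.
have sq : (q `^ 2^-1) ^+ 2 = q.
  by rewrite -powR_mulrn ?powR_ge0// -powRrM mulVf// powRr1.
rewrite poweR_EFin lee_fin powR_mulrn ?mulr_ge0 ?powR_ge0//.
have -> (y : R) : y ^+ k.*2 = (y ^+ 2) ^+ k by rewrite -exprM mul2n.
by rewrite (exprMn 2) sq mulrC.
Qed.

(** Expanding the exponential and bounding the moments by
[subgaussian_even_moment], the [k]-th term is at most [2^-k]; the scale [4 e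
L^2] is chosen to make this happen. *)
Lemma subgaussian_exp_square (Y : T -> R) (L : R) :
  measurable_fun setT Y -> 0 < L -> (subgaussian_norm P Y <= L%:E)%E ->
  (\int[P]_w (expR (Y w ^+ 2 / (4 * expR 1 * L ^+ 2)))%:E <= 2%:E)%E.
Proof.
move=> mY L0 YL; set C := 4 * expR 1 * L ^+ 2.
have C0 : 0 < C by rewrite mulr_gt0 ?exprn_gt0// mulr_gt0 ?expR_gt0.
pose x w := Y w ^+ 2 / C.
have x0 w : 0 <= x w by rewrite divr_ge0 ?sqr_ge0 ?ltW.
have mx : measurable_fun setT x.
  by apply: measurable_funM => //; exact: measurable_funX.
have mxk k : measurable_fun setT (fun w => exp_coeff (x w) k).
  by rewrite /exp_coeff /=; apply: measurable_funM => //; exact: measurable_funX.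
have moment k : (\int[P]_w (exp_coeff (x w) k)%:E <= ((1 / 2) ^+ k)%:E)%E.
  have [->|k0] := posnP k.
    under eq_integral do rewrite /exp_coeff /= expr0 fact0 divr1.
    by rewrite integral_cst// mul1e expr0 probability_le1.
  have E w : exp_coeff (x w) k = (C ^+ k * k`!%:R)^-1 * Y w ^+ k.*2.
    by rewrite /exp_coeff /= /x expr_div_n -exprM mul2n invfM -mulrA mulrC.
  under eq_integral do rewrite E EFinM.
  have c0 : 0 <= (C ^+ k * k`!%:R)^-1 :> R.
    by rewrite invr_ge0 mulr_ge0// exprn_ge0// ltW.
  rewrite ge0_integralZl_EFin//; last 2 first.
  - by move=> w _; rewrite lee_fin -mul2n exprM exprn_ge0// sqr_ge0.
  - by apply/measurable_EFinP; exact: measurable_funX.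
  apply: le_trans (lee_wpmul2l _ (subgaussian_even_moment YL k0)) _.
    by rewrite lee_fin.
  rewrite -EFinM lee_fin mulrC ler_pdivrMr ?mulr_gt0 ?exprn_gt0 ?ltr0n ?fact_gt0//.
  have -> : L ^+ 2 * k.*2%:R = 2 * L ^+ 2 * k%:R by rewrite -mul2n natrM; ring.
  have -> : (1 / 2) ^+ k * (C ^+ k * k`!%:R) =
            (2 * L ^+ 2) ^+ k * (expR 1 ^+ k * k`!%:R).
    by rewrite !mulrA -!exprMn; congr (_ ^+ _ * _); rewrite /C; field.
  rewrite exprMn; apply: ler_wpM2l (pow_self_le_fact _ _).
  by rewrite exprn_ge0// mulr_ge0// sqr_ge0.
have -> : (\int[P]_w (expR (x w))%:E =
           \int[P]_w limn (fun n => (series (exp_coeff (x w)) n)%:E))%E.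
  apply: eq_integral => w _; apply/esym/cvg_lim => //.
  by apply: cvg_EFin; [exact: nearW|exact: is_cvg_series_exp_coeff].
rewrite monotone_convergence//.
- apply: lime_le; last first.
    apply: nearW => n; under eq_integral do rewrite /series/= -sumEFin.
    rewrite ge0_integral_sum//; last 2 first.
    - by move=> k; exact/measurable_EFinP.
    - by move=> k w _; rewrite lee_fin exp_coeff_ge0.
    apply: (@le_trans _ _ (\sum_(0 <= k < n) ((1 / 2 : R) ^+ k)%:E)%E).
      by apply: lee_sum => k _; exact: moment.
    rewrite sumEFin lee_fin.
    suff -> : \sum_(0 <= k < n) (1 / 2) ^+ k = 2 - 2 * (1 / 2) ^+ n :> R.
      by rewrite gerBl mulr_ge0// exprn_ge0.
    elim: n => [|n IH]; first by rewrite big_geq// expr0; ring.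
    by rewrite big_nat_recr//= IH exprS; field.
  apply: ereal_nondecreasing_is_cvgn => m n mn.
  apply: ge0_le_integral => //.
  - by move=> w _; rewrite lee_fin sumr_ge0// => k _; exact: exp_coeff_ge0.
  - by apply/measurable_EFinP; exact: measurable_sum.
  - by apply/measurable_EFinP; exact: measurable_sum.
  - move=> w _; rewrite lee_fin; apply: nondecreasing_series => // k _ _.
    exact: exp_coeff_ge0.
- by move=> n; apply/measurable_EFinP; exact: measurable_sum.
- by move=> n w _; rewrite lee_fin sumr_ge0// => k _; exact: exp_coeff_ge0.
- move=> w _ m n mn; rewrite lee_fin; apply: nondecreasing_series => // k _ _.
  exact: exp_coeff_ge0.
Qed.

(** Convexity in the exponent; a small multiple of the square costs
proportionally little. *)
Lemma exp_square_shrink (Y : T -> R) (C t : R) :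
  measurable_fun setT Y ->
  (\int[P]_w (expR (Y w ^+ 2 / C))%:E <= 2%:E)%E -> 0 <= t -> t <= 1 ->
  (\int[P]_w (expR (t * (Y w ^+ 2 / C)))%:E <= (1 + t)%:E)%E.
Proof.
move=> mY E2 t0 t1.
have mYC : measurable_fun setT (fun w => expR (Y w ^+ 2 / C)).
  apply: measurableT_comp => //; apply: measurable_funM => //.
  exact: measurable_funX.
have mYt : measurable_fun setT (fun w => expR (t * (Y w ^+ 2 / C))).
  apply: measurableT_comp => //; apply: measurable_funM => //.
  by apply: measurable_funM => //; exact: measurable_funX.
apply: (@le_trans _ _
    (\int[P]_w ((1 - t)%:E + t%:E * (expR (Y w ^+ 2 / C))%:E))%E).
  apply: ge0_le_integral => //.
  - exact/measurable_EFinP.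
  - by under eq_fun do rewrite -EFinM -EFinD;
      apply/measurable_EFinP; apply: measurable_funD => //;
      exact: measurable_funM.
  - move=> w _; rewrite -EFinM -EFinD lee_fin.
    by have := expR_interpolate (Y w ^+ 2 / C) t0 t1; lra.
rewrite ge0_integralD//; last 3 first.
- by move=> w _; rewrite lee_fin subr_ge0.
- by move=> w _; rewrite -EFinM lee_fin mulr_ge0 ?expR_ge0.
- by under eq_fun do rewrite -EFinM; apply/measurable_EFinP;
    exact: measurable_funM.
rewrite integral_cst//= probability_setT mule1 ge0_integralZl_EFin//;
  last exact/measurable_EFinP.
apply: (@le_trans _ _ ((1 - t)%:E + t%:E * 2%:E)%E).
  by rewrite leeD2l// lee_wpmul2l// lee_fin.
by rewrite -EFinM -EFinD lee_fin; lra.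
Qed.

Lemma centered_mgf_le (Y : T -> R) (C s : R) :
  measurable_fun setT Y -> P.-integrable setT (fun w => (Y w)%:E) ->
  (\int[P]_w (Y w)%:E = 0)%E -> 0 < C ->
  (\int[P]_w (expR (Y w ^+ 2 / C))%:E <= 2%:E)%E ->
  2 * C * s ^+ 2 <= 1 ->
  (\int[P]_w (expR (s * Y w))%:E <= (expR (2 * C * s ^+ 2))%:E)%E.
Proof.
move=> mY iY EY0 C0 E2 s1.
have C_neq0 : C != 0 by rewrite gt_eqF.
set t := 2 * C * s ^+ 2; have t0 : 0 <= t by rewrite mulr_ge0 ?sqr_ge0// mulr_ge0 ?ltW.
have Et := exp_square_shrink mY E2 t0 s1.
have mYt : measurable_fun setT (fun w => expR (t * (Y w ^+ 2 / C))).
  apply: measurableT_comp => //; apply: measurable_funM => //.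
  by apply: measurable_funM => //; exact: measurable_funX.
have iYt : P.-integrable setT (fun w => (expR (t * (Y w ^+ 2 / C)))%:E).
  apply/integrableP; split; first exact/measurable_EFinP.
  under eq_integral do rewrite abse_EFin ger0_norm ?expR_ge0//.
  exact: le_lt_trans Et (ltry _).
have isY : P.-integrable setT (fun w => s%:E * (Y w)%:E)%E.
  exact: integrableZl.
apply: (@le_trans _ _
    (\int[P]_w (s%:E * (Y w)%:E + (expR (t * (Y w ^+ 2 / C)))%:E))%E).
  apply: ge0_le_integral => //.
  - by apply/measurable_EFinP; apply: measurableT_comp => //;
      exact: measurable_funM.
  - by under eq_fun do rewrite -EFinM -EFinD;
      apply/measurable_EFinP; apply: measurable_funD => //;
      exact: measurable_funM.
  - move=> w _; rewrite -EFinM -EFinD lee_fin.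
    apply: le_trans (expR_le_addsq _) _; rewrite lerD2l ler_expR.
    by rewrite /t le_eqVlt; apply/orP; left; apply/eqP; field.
rewrite integralD// integralZl// EY0 mule0 add0e.
apply: le_trans Et _; rewrite lee_fin.
by have := expR_ge1Dx t.
Qed.

End SubGaussian.

(** * Linear forms in independent sub-Gaussian variables *)

Section LinearForms.
Context d (T : measurableType d) (R : realType) (P : probability T R).
Context (Y : nat -> T -> R) (C : R).
Hypothesis C0 : 0 < C.
Hypothesis mY : forall j, measurable_fun setT (Y j).
Hypothesis indY : mutually_independent P Y.
Hypothesis intY : forall j, P.-integrable setT (fun w => (Y j w)%:E).
Hypothesis EY0 : forall j, (\int[P]_w (Y j w)%:E = 0)%E.
Hypothesis EexpY : forall j, (\int[P]_w (expR (Y j w ^+ 2 / C))%:E <= 2%:E)%E.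

Lemma measurable_linear_form m (a : 'I_m -> R) :
  measurable_fun setT (fun w => \sum_(j < m) a j * Y j w).
Proof. by apply: measurable_sum => j; exact: measurable_funM. Qed.

(** The Laplace transform factors by independence. The hypothesis on the norm
of [a] keeps every coordinate in the range where [centered_mgf_le] applies,
and makes the product of the bounds at most [e]. *)
Lemma linear_form_mgf_le m (a : 'I_m -> R) :
  2 * C * (\sum_(j < m) a j ^+ 2) <= 1 ->
  (\int[P]_w (expR (\sum_(j < m) a j * Y j w))%:E <= (expR 1)%:E)%E.
Proof.
(* Independence is over all natural indices, so [a] is extended by zero. *)
move=> a1; pose b (j : nat) := oapp a 0 (insub j).
have bE (j : 'I_m) : b j = a j by rewrite /b valK.
have sum_b : \sum_(0 <= j < m) b j ^+ 2 = \sum_(j < m) a j ^+ 2.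
  by rewrite big_mkord; apply: eq_bigr => j _; rewrite bE.
have b1 j : 2 * C * b j ^+ 2 <= 1.
  rewrite /b; case: insubP => [i _ _|_] /=; last by rewrite expr0n mulr0 ler01.
  apply: le_trans a1; rewrite ler_wpM2l//; first by rewrite mulr_ge0 ?ltW.
  by rewrite (bigD1 i)//= lerDl sumr_ge0// => k _; exact: sqr_ge0.
have mgf j := centered_mgf_le (mY j) (intY j) (EY0 j) C0 (EexpY j) (b1 j).
have mexp j : measurable_fun setT (fun y : R => expR (b j * y)).
  by apply: measurableT_comp => //; exact: measurable_funM.
have fin j : (\int[P]_w (expR (b j * Y j w))%:E)%E \is a fin_num.
  rewrite ge0_fin_numE; first exact: le_lt_trans (mgf j) (ltry _).
  by apply: integral_ge0 => w _; rewrite lee_fin expR_ge0.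
have -> : (\int[P]_w (expR (\sum_(j < m) a j * Y j w))%:E =
    \int[P]_w (\prod_(0 <= j < m) expR (b j * Y j w))%:E)%E.
  apply: eq_integral => w _; rewrite -expR_sum big_mkord.
  by under [in RHS]eq_bigr do rewrite bE.
rewrite (mutually_independent_expectation_prod (P := P)
  (f := fun j y => expR (b j * y)) indY)//; last exact: iota_uniq.
apply: (@le_trans _ _ (\prod_(0 <= j < m) (expR (2 * C * b j ^+ 2))%:E)%E).
  suff /andP[] : (0 <= \prod_(0 <= j < m) \int[P]_w (expR (b j * Y j w))%:E <=
    \prod_(0 <= j < m) (expR (2 * C * b j ^+ 2))%:E)%E by [].
  apply: (big_ind2 (fun x y => 0 <= x <= y)%E) => [|x1 x2 y1 y2|i _].
  - by rewrite lexx lee01.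
  - move=> /andP[x0 x12] /andP[y0 y12]; rewrite mule_ge0//=.
    exact: lee_pmul.
  - by rewrite mgf andbT; apply: integral_ge0 => w _; rewrite lee_fin expR_ge0.
by rewrite prodEFin lee_fin -expR_sum -mulr_sumr sum_b ler_expR.
Qed.

Lemma linear_form_moment4_le m (a : 'I_m -> R) :
  2 * C * (\sum_(j < m) a j ^+ 2) <= 1 ->
  (\int[P]_w ((\sum_(j < m) a j * Y j w) ^+ 4)%:E <= (2 ^+ 9 * expR 1)%:E)%E.
Proof.
move=> a1; have le1 := linear_form_mgf_le a1.
have a1N : 2 * C * (\sum_(j < m) (- a j) ^+ 2) <= 1.
  by under eq_bigr do rewrite sqrrN.
have := linear_form_mgf_le a1N.
have eqN w : \sum_(j < m) (- a j) * Y j w = - \sum_(j < m) a j * Y j w.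
  by rewrite -sumrN; apply: eq_bigr => j _; rewrite mulNr.
under eq_integral do rewrite eqN.
set S := fun w => \sum_(j < m) a j * Y j w => le2.
have mS : measurable_fun setT S by exact: measurable_linear_form.
have mexp : measurable_fun setT (fun w => expR (S w)) by exact: measurableT_comp.
have mexpN : measurable_fun setT (fun w => expR (- S w)).
  by apply: measurableT_comp => //; exact: measurableT_comp.
have mcosh : measurable_fun setT (fun w => expR (S w) + expR (- S w)).
  exact: measurable_funD.
apply: (@le_trans _ _ (\int[P]_w (2 ^+ 8 * (expR (S w) + expR (- S w)))%:E)%E).
  apply: le_integral_nonneg.
  - exact: measurable_funX.
  - exact: measurable_funM.
  - by move=> w; rewrite -[4%N]/(2 * 2)%N exprM; exact: sqr_ge0.
  - by move=> w; exact: pow4_le_expR.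
rewrite integral_scale_nonneg//.
under eq_integral do rewrite EFinD.
rewrite ge0_integralD//; last 2 first.
- exact/measurable_EFinP.
- exact/measurable_EFinP.
apply: (@le_trans _ _ ((2 ^+ 8)%:E * ((expR 1)%:E + (expR 1)%:E))%E).
  by rewrite lee_wpmul2l ?leeD.
by rewrite -EFinD -EFinM lee_fin; lra.
Qed.

(** Expanding [exp (- t S^2)] to second order needs the second and fourth
moments only: the first order gain [t / (2 C)] is half lost to the threshold
[t / (4 C)], and [t] is such that the second order loss is half of what
remains. *)
Lemma linear_form_lower_mgf m (a : 'I_m -> R) (t : R) :
  0 <= t -> t * (2 ^+ 9 * expR 1) = (8 * C)^-1 ->
  2 * C * (\sum_(j < m) a j ^+ 2) = 1 ->
  (\int[P]_w ((\sum_(j < m) a j * Y j w) ^+ 2)%:E =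
    (\sum_(j < m) a j ^+ 2)%:E)%E ->
  (\int[P]_w (expR (t * ((4 * C)^-1 - (\sum_(j < m) a j * Y j w) ^+ 2)))%:E <=
   (expR (- (t / (8 * C))))%:E)%E.
Proof.
move=> t0 tC a1 E2; have := linear_form_moment4_le (m := m) (a := a).
rewrite a1 => /(_ (lexx _)) E4.
have mS := measurable_linear_form a.
set S := fun w => \sum_(j < m) a j * Y j w in E2 E4 mS *.
have sumE : \sum_(j < m) a j ^+ 2 = (2 * C)^-1.
  have u0 : 2 * C != 0 by rewrite gt_eqF// mulr_gt0.
  by apply: (mulfI u0); rewrite a1 mulfV.
have mX k : measurable_fun setT (fun w => S w ^+ k) by exact: measurable_funX.
pose c := expR (t * (4 * C)^-1).
have c0 : 0 <= c by exact: expR_ge0.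
have m1 : measurable_fun setT (fun w => t * S w ^+ 2).
  exact: measurable_funM.
have S4 w : 0 <= S w ^+ 4.
  by rewrite -[4%N]/(2 * 2)%N exprM; exact: sqr_ge0.
have m4 : measurable_fun setT (fun w => t ^+ 2 * S w ^+ 4).
  exact: measurable_funM.
have E2f : (\int[P]_w (t * S w ^+ 2)%:E = (t * (2 * C)^-1)%:E)%E.
  rewrite integral_scale_nonneg//; first by rewrite E2 sumE.
  by move=> w; exact: sqr_ge0.
have Et4 : (\int[P]_w (t ^+ 2 * S w ^+ 4)%:E <=
            (t ^+ 2 * (2 ^+ 9 * expR 1))%:E)%E.
  rewrite integral_scale_nonneg ?sqr_ge0//.
  rewrite [leRHS]EFinM; apply: lee_wpmul2l => //.
  by rewrite lee_fin sqr_ge0.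
have i2 : P.-integrable setT (fun w => (t * S w ^+ 2)%:E).
  apply: (integrable_nonneg_bounded m1); last by rewrite E2f.
  by move=> w; rewrite mulr_ge0// sqr_ge0.
have i4 : P.-integrable setT (fun w => (t ^+ 2 * S w ^+ 4)%:E).
  apply: (integrable_nonneg_bounded m4 _ Et4) => w.
  by rewrite mulr_ge0// sqr_ge0.
have mexp : measurable_fun setT (fun w => expR (- (t * S w ^+ 2))).
  by apply: measurableT_comp => //; exact: measurableT_comp.
have i1 : P.-integrable setT (fun=> 1%:E : \bar R).
  exact: finite_measure_integrable_cst.
(* The expansion [1 - y + y^2] of [exp (- y)] is integrated term by term. *)
have i12 := integrableB measurableT i1 i2.
have le1 : (\int[P]_w (expR (- (t * S w ^+ 2)))%:E <=
            (1 - t * (2 * C)^-1 + t ^+ 2 * (2 ^+ 9 * expR 1))%:E)%E.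
  apply: (@le_trans _ _ (\int[P]_w
     ((1%:E - (t * S w ^+ 2)%:E) + (t ^+ 2 * S w ^+ 4)%:E))%E).
    apply: le_integral => //.
    - apply: (@integrable_nonneg_bounded _ _ _ _ _ 1 mexp).
        by move=> w; exact: expR_ge0.
      apply: (@le_trans _ _ (\int[P]_w (1 : R)%:E)%E); last first.
        by rewrite integral_cst//= probability_setT mule1.
      apply: le_integral_nonneg => // w.
      by rewrite -expR0 ler_expR oppr_le0 mulr_ge0 ?sqr_ge0.
    - exact: integrableD.
    - move=> w _; rewrite -EFinB -EFinD lee_fin.
      have := @expRN_le_quadratic _ (t * S w ^+ 2).
      rewrite mulr_ge0 ?sqr_ge0// => /(_ isT) /le_trans; apply.
      by rewrite exprMn -exprM.
  rewrite integralD// integralB//= E2f integral_cst//= probability_setT mule1.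
  by rewrite EFinD EFinB leeD2l.
have -> : (\int[P]_w (expR (t * ((4 * C)^-1 - S w ^+ 2)))%:E =
           \int[P]_w (c * expR (- (t * S w ^+ 2)))%:E)%E.
  by apply: eq_integral => w _; rewrite -expRD mulrBr.
rewrite integral_scale_nonneg//.
apply: le_trans (lee_wpmul2l _ le1) _; first by rewrite lee_fin.
rewrite -EFinM lee_fin.
apply: (@le_trans _ _ (c * expR (- (t * (2 * C)^-1) + t ^+ 2 * (2 ^+ 9 * expR 1)))).
  rewrite ler_wpM2l//; apply: le_trans (expR_ge1Dx _); by rewrite addrA.
rewrite /c -expRD ler_expR le_eqVlt; apply/orP; left; apply/eqP.
rewrite expr2 -mulrA tC.
by field; rewrite gt_eqF.
Qed.

End LinearForms.

(** * Lower bounds for quadratic forms from integer vectors *)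

Section LatticeNet.
Context (R : realType).

(** On a unit interval a quadratic polynomial with leading coefficient [q]
lies at most [q / 4] below its chord, so one of the two endpoints exceeds the
value at [x] by at most [q / 4]. *)
Lemma round_coordinate n (c e : 'I_n -> R) (x : R) :
  exists z : int, `|z%:~R - x| <= 1 /\
    \sum_(i < n) (c i + z%:~R * e i) ^+ 2 <=
    \sum_(i < n) (c i + x * e i) ^+ 2 + 1 / 4 * \sum_(i < n) e i ^+ 2.
Proof.
have [z [t0 t1]] : exists z : int, 0 <= x - z%:~R /\ x - z%:~R <= 1.
  exists (Num.floor x); have := floor_le_tmp x; have := floorD1_gt x.
  by rewrite intrD mulr1z => h1 h2; split; lra.
have near_z : `|z%:~R - x| <= 1 by rewrite ler_distlC; apply/andP; split; lra.
have near_z1 : `|(z + 1)%:~R - x| <= 1.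
  by rewrite intrD mulr1z ler_distlC; apply/andP; split; lra.
set t := x - z%:~R in t0 t1.
pose q y := \sum_(i < n) (c i + y * e i) ^+ 2.
pose E := \sum_(i < n) e i ^+ 2.
have E0 : 0 <= E by apply: sumr_ge0 => i _; exact: sqr_ge0.
(* The chord between the two neighbouring integers, evaluated at [x]. *)
have chord : (1 - t) * q z%:~R + t * q (z + 1)%:~R = q x + t * (1 - t) * E.
  rewrite /q /E !mulr_sumr -!big_split/=; apply: eq_bigr => i _.
  by rewrite intrD mulr1z /t; ring.
have tt : t * (1 - t) * E <= 1 / 4 * E.
  by rewrite ler_wpM2r//; have := sqr_ge0 (t - 1 / 2); nra.
have [le_z|lt_z] := leP (q z%:~R) (q x + 1 / 4 * E).
  by exists z.
exists (z + 1); split.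
  by [].
rewrite -/(q _) -/(q _) -/E leNgt; apply/negP => lt_z1.
have [le_q|/ltW le_q] := leP (q z%:~R) (q (z + 1)%:~R).
  have : 0 <= t * (q (z + 1)%:~R - q z%:~R).
    by apply: mulr_ge0 => //; rewrite subr_ge0.
  by lra.
have : 0 <= (1 - t) * (q z%:~R - q (z + 1)%:~R).
  by apply: mulr_ge0; rewrite subr_ge0.
by lra.
Qed.

(** Coordinates are rounded successively, the choice for each being made with
the earlier ones already rounded. The offset [c] collects the latter. *)
Lemma round_vector n (J : eqType) (s : seq J) (e : J -> 'I_n -> R)
    (c : 'I_n -> R) (a : J -> R) : uniq s ->
  exists k : J -> int, (forall j, j \in s -> `|(k j)%:~R - a j| <= 1) /\
    \sum_(i < n) (c i + \sum_(j <- s) (k j)%:~R * e j i) ^+ 2 <=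
    \sum_(i < n) (c i + \sum_(j <- s) a j * e j i) ^+ 2 +
      1 / 4 * \sum_(j <- s) \sum_(i < n) e j i ^+ 2.
Proof.
elim: s c => [|j s IH] c /=.
  move=> _; exists (fun=> 0); split=> //.
  rewrite [X in _ + 1 / 4 * X]big_nil mulr0 addr0.
  by apply: ler_sum => i _; rewrite !big_nil.
move=> /andP[js us].
have [z [za zq]] :=
  round_coordinate (fun i => c i + \sum_(j <- s) a j * e j i) (e j) (a j).
have [k [ka kq]] := IH (fun i => c i + z%:~R * e j i) us.
exists (fun l => if l == j then z else k l); split=> [l|].
  by rewrite inE; case: eqVneq => [->//|lj] /= ls; exact: ka.
have -> : \sum_(i < n) (c i + \sum_(l <- j :: s)
      (if l == j then z else k l)%:~R * e l i) ^+ 2 =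
    \sum_(i < n) (c i + z%:~R * e j i + \sum_(l <- s) (k l)%:~R * e l i) ^+ 2.
  apply: eq_bigr => i _; rewrite big_cons eqxx addrA; congr ((_ + _) ^+ 2).
  rewrite big_seq [RHS]big_seq; apply: eq_bigr => l ls.
  by rewrite ifN//; apply: contraNneq js => <-.
rewrite [X in _ + 1 / 4 * X]big_cons mulrDr addrA; apply: le_trans kq _.
rewrite lerD2r; under [X in X <= _]eq_bigr do rewrite addrAC.
apply: le_trans zq _; rewrite lerD2r; apply: ler_sum => i _.
by rewrite big_cons [X in _ <= (_ + X) ^+ 2]addrC addrA.
Qed.

(** An integer vector, stored as sign and absolute value of each coordinate so
that the vectors of bounded size form a finite type; the origin of each axis
is represented twice. *)
Definition lattice_point m M := {ffun 'I_m -> bool * 'I_M}.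

Definition lattice_vec m M (f : lattice_point m M) (j : 'I_m) : R :=
  (-1) ^+ (f j).1 * (f j).2%:R.

(** A ball of the l1 norm. Since [|k| <= k^2] for integers it contains a
Euclidean ball of squared radius [T], and it is easier to count. *)
Definition lattice_net m M T : {set lattice_point m M} :=
  [set f : lattice_point m M | (\sum_(j < m) (f j).2 <= T)%N].

(** An exponential Markov inequality for the counting measure: each point of
the net has weight at least [2^-T] in a product of geometric weights of total
mass at most [4^m]. *)
Lemma card_lattice_net m M T :
  #|lattice_net m M T|%:R <= 2 ^+ T * 4 ^+ m :> R.
Proof.
have half_sum : \sum_(p : bool * 'I_M) (1 / 2) ^+ p.2 <= 4 :> R.
  rewrite -(pair_bigA _ (fun (b : bool) (i : 'I_M) => (1 / 2 : R) ^+ i))/=.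
  rewrite big_bool/=.
  suff -> : \sum_(i < M) (1 / 2) ^+ i = 2 - 2 * (1 / 2) ^+ M :> R.
    by have := @exprn_ge0 R M (1 / 2) (ltac:(lra)); lra.
  elim: M => [|M IH]; first by rewrite big_ord0 expr0; ring.
  by rewrite big_ord_recr/= IH exprS; field.
rewrite -sum1_card natr_sum.
apply: (@le_trans _ _ (\sum_(f : lattice_point m M)
    2 ^+ T * \prod_(j < m) (1 / 2) ^+ (f j).2)).
  rewrite big_mkcond/=; apply: ler_sum => f _; rewrite inE.
  rewrite prodrXr; case: ifP => [le_T|_]; last first.
    by rewrite mulr_ge0 ?exprn_ge0//; lra.
  rewrite div1r exprVn ler_pdivlMr ?exprn_gt0// mul1r.
  by rewrite ler_weXn2l//; lra.
rewrite -mulr_sumr ler_wpM2l ?exprn_ge0//.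
rewrite -(bigA_distr_bigA (fun (j : 'I_m) (p : bool * 'I_M) => (1 / 2 : R) ^+ p.2)).
rewrite prodr_const card_ord; apply: lerXn2r => //; rewrite nnegrE//.
by rewrite sumr_ge0// => p _; rewrite exprn_ge0//; lra.
Qed.

(** After scaling [a] to squared length [(2 B + 4) m], its rounding [k] has
squared length between [(B + 1) m] and [(4 B + 10) m]. The form is large at
[k], and passing back from [k] to [a] costs [n m B / 4] at most. *)
Lemma quadratic_form_lower m n (eta : 'I_n -> 'I_m -> R) (B : R) (S : nat) :
  0 <= B -> 4 * B + 10 <= S%:R ->
  \sum_(i < n) \sum_(j < m) eta i j ^+ 2 <= n%:R * m%:R * B ->
  (forall f : lattice_point m (S * m).+1, f \in lattice_net m (S * m).+1 (S * m) ->
     0 < \sum_(j < m) lattice_vec f j ^+ 2 ->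
     n%:R * (\sum_(j < m) lattice_vec f j ^+ 2) / 2 <=
     \sum_(i < n) (\sum_(j < m) lattice_vec f j * eta i j) ^+ 2) ->
  forall a : 'I_m -> R,
    n%:R * (\sum_(j < m) a j ^+ 2) / 8 <=
    \sum_(i < n) (\sum_(j < m) a j * eta i j) ^+ 2.
Proof.
move=> B0 BS trace_le net_ge a.
set A := \sum_(j < m) a j ^+ 2.
have A0 : 0 <= A by apply: sumr_ge0 => j _; exact: sqr_ge0.
have [A_eq0|A_neq0] := eqVneq A 0.
  by rewrite A_eq0 mulr0 mul0r sumr_ge0// => i _; exact: sqr_ge0.
have A_gt0 : 0 < A by rewrite lt_neqAle eq_sym A_neq0.
have m_gt0 : (0 < m)%N.
  by case: m eta S BS a @A net_ge trace_le A0 A_neq0 A_gt0 => // eta S _ a A _ _ _;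
     rewrite /A big_ord0 eqxx.
have mR : 0 < m%:R :> R by rewrite ltr0n.
(* The radius is chosen so large that rounding errors are negligible. *)
pose r2 := 2 * B + 4.
pose l := Num.sqrt (r2 * m%:R / A).
have l2 : l ^+ 2 = r2 * m%:R / A.
  by rewrite sqr_sqrtr// divr_ge0// mulr_ge0// /r2; lra.
have [k [ka kq]] := round_vector (fun j i => eta i j) (fun=> 0)
  (fun j => l * a j) (index_enum_uniq 'I_m).
have {}ka j : `|(k j)%:~R - l * a j| <= 1 by apply: ka; rewrite mem_index_enum.
have sum_la : \sum_(j < m) (l * a j) ^+ 2 = r2 * m%:R.
  under eq_bigr do rewrite exprMn.
  by rewrite -mulr_sumr l2 divfK.
have m1 : m%:R = \sum_(j < m) (1 : R) by rewrite sumr_const card_ord.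
have d2 j : ((k j)%:~R - l * a j) ^+ 2 <= 1.
  by rewrite -real_normK ?num_real// expr_le1.
have k_ge : r2 * m%:R / 2 - m%:R <= \sum_(j < m) (k j)%:~R ^+ 2.
  rewrite -sum_la [X in _ - X]m1 mulr_suml -sumrB; apply: ler_sum => j _.
  have := d2 j; have := sqr_ge0 (2 * (k j)%:~R - l * a j); nra.
have k_le : \sum_(j < m) (k j)%:~R ^+ 2 <= 2 * (r2 * m%:R) + 2 * m%:R.
  rewrite -sum_la [X in _ + 2 * X]m1 !mulr_sumr -big_split/=.
  apply: ler_sum => j _.
  have := d2 j; have := sqr_ge0 ((k j)%:~R - 2 * (l * a j)); nra.
have absk_le : (\sum_(j < m) `|k j|%N <= S * m)%N.
  rewrite -(ler_nat R) natr_sum natrM.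
  apply: (@le_trans _ _ (\sum_(j < m) (k j)%:~R ^+ 2)).
    apply: ler_sum => j _; rewrite -[(k j)%:~R ^+ 2]real_normK ?num_real//.
    rewrite -intr_norm -natr_absz.
    by case: `|k j|%N => [|p]; rewrite ?expr0n// -natrX ler_nat leq_pmulr.
  apply: le_trans k_le _; rewrite /r2; nra.
have kM j : (`|k j|%N < (S * m).+1)%N.
  rewrite ltnS (leq_trans _ absk_le)//.
  by rewrite (bigD1 j)//= leq_addr.
pose f : lattice_point m (S * m).+1 := [ffun j => ((k j < 0), Ordinal (kM j))].
have fk j : lattice_vec f j = (k j)%:~R.
  by rewrite /lattice_vec ffunE/= [in RHS](intEsign (k j)) intrM intr_sign.
have f_net : f \in lattice_net m (S * m).+1 (S * m).
  by rewrite inE; under eq_bigr do rewrite ffunE.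
have := net_ge f f_net.
have -> : \sum_(j < m) lattice_vec f j ^+ 2 = \sum_(j < m) (k j)%:~R ^+ 2.
  by apply: eq_bigr => j _; rewrite fk.
have -> : \sum_(i < n) (\sum_(j < m) lattice_vec f j * eta i j) ^+ 2 =
          \sum_(i < n) (0 + \sum_(j < m) (k j)%:~R * eta i j) ^+ 2.
  apply: eq_bigr => i _; rewrite add0r; congr (_ ^+ 2).
  by apply: eq_bigr => j _; rewrite fk.
have -> : 0 < \sum_(j < m) (k j)%:~R ^+ 2 :> R.
  by apply: lt_le_trans k_ge; rewrite /r2; nra.
move=> /(_ isT) Qk.
have Qa : \sum_(i < n) (0 + \sum_(j < m) l * a j * eta i j) ^+ 2 =
          l ^+ 2 * \sum_(i < n) (\sum_(j < m) a j * eta i j) ^+ 2.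
  rewrite mulr_sumr; apply: eq_bigr => i _; rewrite add0r -exprMn mulr_sumr.
  by congr (_ ^+ 2); apply: eq_bigr => j _; rewrite mulrA.
rewrite exchange_big/= in kq.
rewrite Qa in kq.
have n0 : 0 <= n%:R :> R by [].
have lpos : 0 < l ^+ 2 by rewrite l2 divr_gt0// mulr_gt0// /r2; lra.
rewrite -(ler_pM2l lpos).
set Q := \sum_(i < n) (\sum_(j < m) a j * eta i j) ^+ 2 in kq *.
have -> : l ^+ 2 * (n%:R * A / 8) = n%:R * m%:R * r2 / 8.
  by rewrite l2; field.
have nk := ler_wpM2l n0 k_ge.
rewrite /r2 in nk *.
set K := \sum_(j < m) (k j)%:~R ^+ 2 in nk Qk.
set Z := \sum_(i < n) (0 + _) ^+ 2 in kq Qk.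
set E := \sum_(i < n) \sum_(j < m) eta i j ^+ 2 in kq trace_le.
lra.
Qed.

End LatticeNet.

(** * Projections in a Hilbert space *)

Section HilbertGeometry.
Context (R : realType) (H : completeNormedModType R) (ip : {dot H for idfun}).
Hypothesis normE : induces_norm ip.

Lemma ipC x y : ip x y = ip y x.
Proof. by rewrite hermC expr0 mul1r. Qed.

Lemma ipZl a x y : ip (a *: x) y = a * ip x y.
Proof. exact: linearZl. Qed.

Lemma ipZr a x y : ip x (a *: y) = a * ip x y.
Proof. by rewrite ipC ipZl ipC. Qed.

Lemma ip_suml (I : Type) (s : seq I) (F : I -> H) y :
  ip (\sum_(i <- s) F i) y = \sum_(i <- s) ip (F i) y.
Proof. by rewrite linear_sumlz. Qed.

Lemma ip_sumr (I : Type) (s : seq I) (F : I -> H) y :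
  ip y (\sum_(i <- s) F i) = \sum_(i <- s) ip y (F i).
Proof. by rewrite ipC ip_suml; apply: eq_bigr => i _; rewrite ipC. Qed.

Lemma parallelogram_le (x y : H) :
  `|x + y| ^+ 2 <= 2 * `|x| ^+ 2 + 2 * `|y| ^+ 2.
Proof.
have : 0 <= `|x - y| ^+ 2 by exact: sqr_ge0.
rewrite -!normE !linearBl !linearBr/= !linearDl !linearDr/= (ipC y x).
by lra.
Qed.

Lemma cauchy_schwarz (x y : H) : `|ip x y| <= `|x| * `|y|.
Proof.
rewrite -ler_sqr ?nnegrE ?mulr_ge0// real_normK ?num_real// exprMn.
have [->|y0] := eqVneq y 0; first by rewrite linear0r expr0n normr0 expr0n mulr0.
have y2 : 0 < `|y| ^+ 2 by rewrite exprn_gt0// normr_gt0.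
have : 0 <= `|x - (ip x y / `|y| ^+ 2) *: y| ^+ 2 by exact: sqr_ge0.
rewrite -normE linearBl !linearBr/= !ipZl !ipZr (ipC y x) !normE.
set c := ip x y; rewrite [leRHS](_ : _ = `|x| ^+ 2 - c ^+ 2 / `|y| ^+ 2).
  by rewrite subr_ge0 ler_pdivrMr.
by field; rewrite gt_eqF// normr_gt0.
Qed.

Lemma ip_continuous v : continuous (fun x => ip x v : R).
Proof.
move=> x; apply/cvgrPdist_le => eps eps0; near=> y.
rewrite -linearBl (le_trans (cauchy_schwarz _ _))//.
have v0 : 0 < `|v| + 1 by rewrite ltr_wpDl.
apply: (@le_trans _ _ (eps / (`|v| + 1) * (`|v| + 1))).
  apply: ler_pM => //; last by rewrite lerDl.
  by near: y; apply: cvgr_dist_le => //; exact: divr_gt0.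
by rewrite divfK// gt_eqF.
Unshelve. all: by end_near. Qed.

Section OrthonormalBasis.
Context (e : nat -> H).
Hypothesis onb : orthonormal_basis ip e.

Local Lemma basis_ip i j : ip (e i) (e j) = (i == j)%:R.
Proof. exact: (proj1 onb). Qed.

Lemma ip_basis_projection d k x : (k < d)%N ->
  ip (e k) (projection_le ip e d x) = ip (e k) x.
Proof.
move=> kd; rewrite ip_sumr (bigD1 (Ordinal kd))//= ipZr basis_ip eqxx mulr1.
rewrite big1 ?addr0// => j jk; rewrite ipZr basis_ip eq_sym.
by rewrite (_ : (_ == _) = false) ?mulr0//;
  apply: contraNF jk => /eqP jk; exact/eqP/val_inj.
Qed.

Lemma ip_projection d x y :
  ip (projection_le ip e d x) y = \sum_(k < d) ip (e k) x * ip (e k) y.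
Proof. by rewrite ip_suml; apply: eq_bigr => k _; rewrite ipZl. Qed.

Lemma residual_norm d x : `|x - projection_le ip e d x| ^+ 2 =
  `|x| ^+ 2 - \sum_(k < d) ip (e k) x ^+ 2.
Proof.
set p := projection_le ip e d x.
have pp : ip p p = \sum_(k < d) ip (e k) x ^+ 2.
  rewrite {1}/p ip_projection; apply: eq_bigr => k _.
  by rewrite ip_basis_projection// ltn_ord.
have px : ip p x = \sum_(k < d) ip (e k) x ^+ 2.
  by rewrite /p ip_projection; apply: eq_bigr.
rewrite -!normE linearBl !linearBr/= (ipC x p) pp px.
by rewrite subrr subr0.
Qed.

Lemma bessel_inequality d x : \sum_(k < d) ip (e k) x ^+ 2 <= `|x| ^+ 2.
Proof. by rewrite -subr_ge0 -residual_norm sqr_ge0. Qed.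

Lemma residual_norm_le d x : `|x - projection_le ip e d x| ^+ 2 <= `|x| ^+ 2.
Proof. by rewrite residual_norm gerBl sumr_ge0// => k _; exact: sqr_ge0. Qed.

Lemma projection_cvg x : projection_le ip e n x @[n --> \oo] --> x.
Proof.
have := proj2 onb x; apply: cvg_trans; apply: near_eq_cvg.
by apply: nearW => n; rewrite /series/= big_mkord.
Qed.

Lemma projectionD d x y :
  projection_le ip e d (x + y) = projection_le ip e d x + projection_le ip e d y.
Proof.
rewrite /projection_le -big_split; apply: eq_bigr => k _ /=.
by rewrite /tensor linearDr/= scalerDl.
Qed.

Lemma residual_add_le d x y :
  `|x + y - projection_le ip e d (x + y)| ^+ 2 <=
  2 * `|x - projection_le ip e d x| ^+ 2 + 2 * `|y - projection_le ip e d y| ^+ 2.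
Proof. by rewrite projectionD opprD addrACA parallelogram_le. Qed.

Lemma residual_partial_sum d N x : (d <= N)%N ->
  \sum_(d <= k < N) ip (e k) x ^+ 2 =
  `|x - projection_le ip e d x| ^+ 2 - `|x - projection_le ip e N x| ^+ 2.
Proof.
move=> dN; rewrite !residual_norm -!(big_mkord xpredT (fun k => ip (e k) x ^+ 2)).
by rewrite (@big_cat_nat _ _ _ d 0 N)//=; ring.
Qed.

Lemma residual_partial_sum_le d N x :
  \sum_(d <= k < N) ip (e k) x ^+ 2 <= `|x - projection_le ip e d x| ^+ 2.
Proof.
have [dN|/ltnW Nd] := leqP d N; last by rewrite big_geq// sqr_ge0.
by rewrite residual_partial_sum// gerBl sqr_ge0.
Qed.

(** Parseval's identity for the orthogonal complement of the first [d] basis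
vectors. *)
Lemma residual_sum_cvg d x :
  \sum_(d <= k < N) ip (e k) x ^+ 2 @[N --> \oo] -->
  `|x - projection_le ip e d x| ^+ 2.
Proof.
suff res0 : `|x - projection_le ip e N x| ^+ 2 @[N --> \oo] --> (0 : R).
  have : `|x - projection_le ip e d x| ^+ 2 -
         `|x - projection_le ip e N x| ^+ 2 @[N --> \oo] -->
         `|x - projection_le ip e d x| ^+ 2 - 0.
    by apply: cvgB res0; exact: cvg_cst.
  rewrite subr0; apply: cvg_trans; apply: near_eq_cvg.
  by near=> N; rewrite residual_partial_sum//; near: N; exact: nbhs_infty_ge.
have -> : 0 = `|x - x| ^+ 2 :> R by rewrite subrr normr0 expr0n.
rewrite expr2; under eq_fun do rewrite expr2.
have res : x - projection_le ip e N x @[N --> \oo] --> x - x.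
  by apply: cvgB; [exact: cvg_cst|exact: projection_cvg].
by apply: cvgM; apply: cvg_norm.
Unshelve. all: by end_near. Qed.

End OrthonormalBasis.

End HilbertGeometry.

(** * Optimality of the empirical projection *)

Section SampleCovariance.
Context (R : realType) (H : completeNormedModType R) (ip : {dot H for idfun}).
Hypothesis normE : induces_norm ip.
Context (n : nat) (x : 'I_n -> H).

Let S (v : H) : H := n%:R^-1 *: \sum_(i < n) tensor ip (x i) (x i) v.

Lemma sample_form v w : ip (S v) w = n%:R^-1 * \sum_(i < n) ip (x i) v * ip (x i) w.
Proof.
by rewrite ipZl ip_suml; congr (_ * _); apply: eq_bigr => i _; rewrite ipZl.
Qed.

Context (lamh : nat -> R) (uh : nat -> H).
Hypothesis spec : spectral_decomposition ip S lamh uh.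

(** The spectral decomposition of the quadratic form, obtained by expanding
one of the two arguments of the inner product and moving the operator to the
other. *)
Lemma sample_form_cvg v :
  \sum_(k < N) lamh k * ip (uh k) v ^+ 2 @[N --> \oo] --> (ip (S v) v : R).
Proof.
have [onb Su _ _] := spec.
have : (ip (projection_le ip uh N v) (S v) : R) @[N --> \oo] --> (ip v (S v) : R).
  exact: (@continuous_cvg _ _ _ _ _ _ (fun y => ip y (S v) : R) _
    (@ip_continuous _ _ _ normE (S v) v) (@projection_cvg _ _ _ _ onb v)).
rewrite [ip v _]ipC; apply: cvg_trans; apply: near_eq_cvg; apply: nearW => N.
rewrite (ip_projection ip); apply: eq_bigr => k _.
have -> : ip (uh k) (S v) = lamh k * ip (uh k) v.
  rewrite -ipZl -Su ipC !sample_form; congr (_ * _).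
  by apply: eq_bigr => i _; rewrite mulrC.
by rewrite expr2 mulrCA.
Qed.

(** Replacing each eigenvalue beyond the [d]-th by [lamh d], which is not
smaller, leaves a multiple of the identity plus a form of rank [d]. *)
Lemma sample_form_le_truncated d v :
  ip (S v) v <=
  \sum_(k < d) (lamh k - lamh d) * ip (uh k) v ^+ 2 + lamh d * `|v| ^+ 2.
Proof.
have [onb Su dec lamh0] := spec.
apply: (ler_cvg_to (@sample_form_cvg v) (cvg_cst _)).
near=> N; have dN : (d <= N)%N by near: N; exact: nbhs_infty_ge.
rewrite -(big_mkord xpredT (fun k => lamh k * ip (uh k) v ^+ 2)).
rewrite -(big_mkord xpredT (fun k => (lamh k - lamh d) * ip (uh k) v ^+ 2)).
apply: (@le_trans _ _ (\sum_(0 <= k < d) (lamh k - lamh d) * ip (uh k) v ^+ 2 +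
    \sum_(0 <= k < N) lamh d * ip (uh k) v ^+ 2)).
  rewrite !(@big_cat_nat _ _ _ d 0 N)//= addrA -big_split/=.
  under [X in _ <= X + _]eq_bigr do rewrite -mulrDl subrK.
  rewrite lerD2l big_nat_cond [leRHS]big_nat_cond; apply: ler_sum => k.
  by rewrite andbT => /andP[dk _]; rewrite ler_wpM2r ?sqr_ge0// dec.
rewrite lerD2l -mulr_sumr ler_wpM2l// big_mkord.
exact: (bessel_inequality normE onb).
Unshelve. all: by end_near. Qed.

(** Ky Fan's principle. Summing [sample_form_le_truncated] over an orthonormal
family of [d] vectors, Bessel's inequality bounds the weight of each of the
first [d] eigenvalues by one. *)
Lemma empirical_pca_optimal (u : nat -> H) d : orthonormal_basis ip u -> (0 < n)%N ->
  \sum_(i < n) `|x i - projection_le ip uh d (x i)| ^+ 2 <=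
  \sum_(i < n) `|x i - projection_le ip u d (x i)| ^+ 2.
Proof.
move=> onbu n0; have [onb Su dec lamh0] := spec.
have nR : 0 < n%:R :> R by rewrite ltr0n.
under eq_bigr do rewrite (residual_norm normE onb).
under [leRHS]eq_bigr do rewrite (residual_norm normE onbu).
rewrite !sumrB lerD2l lerN2.
have formE (v : nat -> H) : \sum_(i < n) \sum_(k < d) ip (v k) (x i) ^+ 2 =
    n%:R * \sum_(k < d) ip (S (v k)) (v k).
  rewrite exchange_big/= mulr_sumr; apply: eq_bigr => k _.
  rewrite sample_form mulrA divff ?gt_eqF// mul1r.
  by apply: eq_bigr => i _; rewrite ipC expr2.
rewrite !formE ler_pM2l//.
have -> : \sum_(k < d) ip (S (uh k)) (uh k) = \sum_(k < d) lamh k.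
  by apply: eq_bigr => k _; rewrite Su ipZl (basis_ip onb) eqxx mulr1.
apply: (@le_trans _ _ (\sum_(j < d) (\sum_(k < d) (lamh k - lamh d) *
    ip (uh k) (u j) ^+ 2 + lamh d))).
  apply: ler_sum => j _; apply: le_trans (sample_form_le_truncated d _) _.
  by rewrite lerD2l -normE (basis_ip onbu) eqxx mulr1.
rewrite big_split/= exchange_big/= -big_split/=; apply: ler_sum => k _.
rewrite -mulr_sumr -lerBrDr ler_piMr//.
  by rewrite subr_ge0 dec// ltnW.
apply: (@le_trans _ _ (`|uh k| ^+ 2)); last by rewrite -normE (basis_ip onb) eqxx.
under eq_bigr do rewrite ipC.
exact: (bessel_inequality normE onbu).
Qed.

(** The residual of [u_j] is expanded along the [uh k] with [k >= d]. For
fixed [k] the weighted coefficients [sqrt (lam j) <uh k, u j>] form a vector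
to which the hypothesis applies, and summing over [k] gives the empirical
error of [uh] on the projected sample. Passing to the sample itself and using
optimality costs a further factor [4]. *)
Lemma leading_error_le (lam : nat -> R) (u : nat -> H) d :
  (0 < n)%N -> orthonormal_basis ip u -> (forall j, 0 < lam j) ->
  (forall a : 'I_d -> R, n%:R * (\sum_(j < d) a j ^+ 2) / 8 <=
     \sum_(i < n) (\sum_(j < d)
        a j * ((Num.sqrt (lam j))^-1 * ip (x i) (u j))) ^+ 2) ->
  \sum_(j < d) lam j * `|u j - projection_le ip uh d (u j)| ^+ 2 <=
  32 * (n%:R^-1 * \sum_(i < n) `|x i - projection_le ip u d (x i)| ^+ 2).
Proof.
move=> n0 onbu lam0 lower; have [onb _ _ _] := spec.
have nR : 0 < n%:R :> R by rewrite ltr0n.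
pose p i := projection_le ip u d (x i).
apply: (@le_trans _ _
    (8 * (n%:R^-1 * \sum_(i < n) `|p i - projection_le ip uh d (p i)| ^+ 2))).
  have cvg_left : \sum_(j < d) lam j * (\sum_(d <= k < N) ip (uh k) (u j) ^+ 2)
      @[N --> \oo] -->
      \sum_(j < d) lam j * `|u j - projection_le ip uh d (u j)| ^+ 2.
    apply: cvg_big => [|j _]; first exact: add_continuous.
    by apply: cvgM; [exact: cvg_cst|exact: residual_sum_cvg].
  apply: (ler_cvg_to cvg_left (cvg_cst _)).
  apply: nearW => N.
  apply: (@le_trans _ _ (8 * (n%:R^-1 * \sum_(i < n)
      \sum_(d <= k < N) ip (uh k) (p i) ^+ 2))); last first.
    rewrite ler_pM2l// ler_pM2l ?invr_gt0//; apply: ler_sum => i _.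
    exact: residual_partial_sum_le.
  under eq_bigr do rewrite mulr_sumr.
  rewrite exchange_big/= [in leRHS]exchange_big/= !mulr_sumr.
  apply: ler_sum => k _.
  have := lower (fun j => Num.sqrt (lam j) * ip (uh k) (u j)).
  have -> : \sum_(j < d) (Num.sqrt (lam j) * ip (uh k) (u j)) ^+ 2 =
            \sum_(j < d) lam j * ip (uh k) (u j) ^+ 2.
    by apply: eq_bigr => j _; rewrite exprMn sqr_sqrtr// ltW.
  have -> : \sum_(i < n) (\sum_(j < d) Num.sqrt (lam j) * ip (uh k) (u j) *
      ((Num.sqrt (lam j))^-1 * ip (x i) (u j))) ^+ 2 =
      \sum_(i < n) ip (uh k) (p i) ^+ 2.
    apply: eq_bigr => i _; congr (_ ^+ 2).
    rewrite [RHS]ipC (ip_projection ip); apply: eq_bigr => j _.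
    rewrite mulrACA divff ?mul1r; last by rewrite gt_eqF// sqrtr_gt0.
    by rewrite [ip (uh k) _]ipC [ip (x i) _]ipC mulrC.
  rewrite mulrCA ler_pdivlMl//.
  set A := \sum_(j < d) _; set B := \sum_(i < n) _; lra.
have step i : `|p i - projection_le ip uh d (p i)| ^+ 2 <=
    2 * `|x i - projection_le ip uh d (x i)| ^+ 2 + 2 * `|x i - p i| ^+ 2.
  have := residual_add_le normE uh d (x i) (p i - x i).
  rewrite [x i + _]addrC subrK => /le_trans; apply; rewrite lerD2l ler_pM2l//.
  by rewrite (distrC (x i) (p i)) (residual_norm_le normE onb).
have := empirical_pca_optimal d onbu n0.
rewrite !(mulrCA _ n%:R^-1) ler_pM2l ?invr_gt0// => optimal.
apply: (@le_trans _ _ (8 * (2 * \sum_(i < n) `|x i - projection_le ip uh d (x i)| ^+ 2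
   + 2 * \sum_(i < n) `|x i - p i| ^+ 2))).
  by rewrite ler_pM2l// !mulr_sumr -big_split/=; apply: ler_sum => i _.
rewrite -/p in optimal; rewrite /p; lra.
Qed.

End SampleCovariance.

(** * Borel functions on a Hilbert space *)

Section BorelFunctions.
Context (R : realType) (H : completeNormedModType R).

Lemma continuous_borel_measurable (f : H -> R) :
  continuous f -> measurable_fun setT (f : borel H -> R).
Proof.
move=> /continuousP cf; apply: (measurability _ (RGenOpens.measurableE R)).
move=> _ [_ [a [b ->]] <-]; rewrite setTI; apply: sub_sigma_algebra.
exact/cf/interval_open.
Qed.

Lemma ip_borel_measurable (ip : {dot H for idfun}) (v : H) :
  induces_norm ip -> measurable_fun setT (fun x : borel H => ip x v : R).
Proof.
by move=> normE; apply: (continuous_borel_measurable (@ip_continuous _ _ _ normE v)).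
Qed.

Lemma norm2_borel_measurable :
  measurable_fun setT (fun x : borel H => `|x : H| ^+ 2 : R).
Proof.
apply: measurable_funX; apply: (continuous_borel_measurable (f := fun x => `|x|)).
by move=> x; apply: cvg_norm; exact: cvg_id.
Qed.

Lemma residual_borel_measurable (ip : {dot H for idfun}) (e : nat -> H) d :
  induces_norm ip -> orthonormal_basis ip e ->
  measurable_fun setT
    (fun x : borel H => `|(x : H) - projection_le ip e d (x : H)| ^+ 2 : R).
Proof.
move=> normE onb.
rewrite (_ : (fun _ => _) = (fun x : borel H =>
    `|x : H| ^+ 2 - \sum_(k < d) ip (x : H) (e k) ^+ 2)); last first.
  apply/funext => x; rewrite (residual_norm normE onb); congr (_ - _).
  by apply: eq_bigr => k _; rewrite ipC.
apply: measurable_funB; first exact: norm2_borel_measurable.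
apply: measurable_sum => k; apply: measurable_funX.
exact: ip_borel_measurable.
Qed.

End BorelFunctions.

(** * Uncorrelated and sub-Gaussian families *)

Section SecondMoments.
Context d (T : measurableType d) (R : realType) (P : probability T R).
Context (Z : nat -> T -> R).
Hypothesis intZ :
  forall j l, P.-integrable setT (fun w => (Z j w * Z l w)%:E).
Hypothesis EZ :
  forall j l, (\int[P]_w (Z j w * Z l w)%:E = ((j == l)%:R)%:E)%E.

(** Stated for bilinear forms, because it serves both scalar combinations of
the [Z j] and squared norms of vector combinations, with the Gram matrix for
[c]. *)
Lemma orthonormal_second_moment m (c : 'I_m -> 'I_m -> R) :
  (\int[P]_w (\sum_(j < m) \sum_(l < m) c j l * (Z j w * Z l w))%:E =
   (\sum_(j < m) c j j)%:E)%E.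
Proof.
under eq_integral do rewrite pair_big/= -sumEFin.
rewrite integral_sum//; last first.
  by move=> p; under eq_fun do rewrite EFinM; exact: integrableZl.
under eq_bigr do [under eq_integral do rewrite EFinM];
  under eq_bigr do rewrite integralZl// EZ -EFinM.
rewrite sumEFin -(pair_big xpredT xpredT
  (fun j l : 'I_m => c j l * (j == l :> nat)%:R))/=; congr (_%:E).
apply: eq_bigr => j _; rewrite (bigD1 j)//= eqxx mulr1 big1 ?addr0// => l lj.
rewrite (_ : (_ == _) = false) ?mulr0//; apply: contraNF lj => /eqP jl.
exact/eqP/val_inj/esym.
Qed.

Lemma linear_form_second_moment m (a : 'I_m -> R) :
  (\int[P]_w ((\sum_(j < m) a j * Z j w) ^+ 2)%:E = (\sum_(j < m) a j ^+ 2)%:E)%E.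
Proof.
have := orthonormal_second_moment (fun j l : 'I_m => a j * a l).
under [in X in _ -> _ = X]eq_bigr do rewrite expr2.
move=> <-; apply: eq_integral => w _; congr (_%:E).
rewrite expr2 mulr_suml; apply: eq_bigr => j _; rewrite mulr_sumr.
by apply: eq_bigr => l _; rewrite mulrACA.
Qed.

End SecondMoments.

Section SquareAverages.
Context d (T : measurableType d) (R : realType) (P : probability T R).
Context (Y : nat -> T -> R) (C : R).
Hypothesis mY : forall j, measurable_fun setT (Y j).
Hypothesis EexpY : forall j, (\int[P]_w (expR (Y j w ^+ 2 / C))%:E <= 2%:E)%E.

(** By convexity the exponential of an average of squares inherits the bound
of a single one. *)
Lemma weighted_squares_exp_le (s : seq nat) (wt : nat -> R) :
  (forall j, 0 <= wt j) -> \sum_(j <- s) wt j <= 1 ->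
  (\int[P]_w (expR (\sum_(j <- s) wt j * (Y j w ^+ 2 / C)))%:E <= 2%:E)%E.
Proof.
move=> wt0 wt1.
have mYC j : measurable_fun setT (fun w => Y j w ^+ 2 / C).
  by apply: measurable_funM => //; exact: measurable_funX.
have mexp j : measurable_fun setT (fun w => expR (Y j w ^+ 2 / C)).
  exact: measurableT_comp.
have msum : measurable_fun setT (fun w => \sum_(j <- s) wt j * expR (Y j w ^+ 2 / C)).
  by apply: measurable_sum => j; exact: measurable_funM.
apply: (@le_trans _ _ (\int[P]_w ((1 - \sum_(j <- s) wt j) +
    \sum_(j <- s) wt j * expR (Y j w ^+ 2 / C))%:E)%E).
  apply: le_integral_nonneg.
  - apply: measurableT_comp => //; apply: measurable_sum => j.
    exact: measurable_funM.
  - exact: measurable_funD.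
  - by move=> w; exact: expR_ge0.
  - move=> w; have := expR_convex_sum (fun j => Y j w ^+ 2 / C) wt0 wt1.
    move=> /le_trans; apply; rewrite -addrA lerD2l le_eqVlt; apply/orP; left.
    apply/eqP; rewrite addrC -sumrB; apply: eq_bigr => j _.
    by rewrite mulrBr mulr1.
under eq_integral do rewrite EFinD -sumEFin.
rewrite ge0_integralD//; last 3 first.
- by move=> w _; rewrite lee_fin subr_ge0.
- by move=> w _; rewrite sumEFin lee_fin sumr_ge0// => j _; rewrite mulr_ge0 ?expR_ge0.
- by under eq_fun do rewrite sumEFin; exact/measurable_EFinP.
rewrite integral_cst//= probability_setT mule1 ge0_integral_sum//; last 2 first.
- by move=> j; apply/measurable_EFinP; exact: measurable_funM.
- by move=> j w _; rewrite lee_fin mulr_ge0 ?expR_ge0.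
apply: (@le_trans _ _ ((1 - \sum_(j <- s) wt j)%:E + \sum_(j <- s) (wt j * 2)%:E)%E).
  rewrite leeD2l//; apply: lee_sum => j _.
  rewrite integral_scale_nonneg//.
  by rewrite EFinM lee_wpmul2l// lee_fin.
by rewrite sumEFin -EFinD lee_fin -mulr_suml; lra.
Qed.

End SquareAverages.

(** * Karhunen-Loeve coefficients *)

Section KarhunenLoeve.
Context (R : realType) (H : completeNormedModType R) (ip : {dot H for idfun}).
Context (dT : measure_display) (Omega : measurableType dT)
  (P : probability Omega R) (X : {RV P >-> borel H}) (Sigma : H -> H)
  (lam : nat -> R) (u : nat -> H).
Hypothesis normE : induces_norm ip.
Hypothesis meanX : has_mean P ip X 0.
Hypothesis sqintX : square_integrable P (X : Omega -> H).
Hypothesis covX : is_covariance P ip X Sigma.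
Hypothesis specX : spectral_decomposition ip Sigma lam u.
Hypothesis lam0 : forall j, 0 < lam j.

Let eta := KL_coefficient ip X lam u.

Lemma measurable_ip_rv v : measurable_fun setT (fun w => ip (X w) v : R).
Proof. exact: (measurableT_comp (ip_borel_measurable v normE)). Qed.

Lemma measurable_norm2_rv : measurable_fun setT (fun w => `|X w : H| ^+ 2 : R).
Proof.
apply: (@measurableT_comp _ _ _ _ _ _ (fun x : borel H => `|x : H| ^+ 2 : R) _ X).
  exact: norm2_borel_measurable.
by [].
Qed.

Lemma measurable_KL j : measurable_fun setT (eta j).
Proof. by apply: measurable_funM => //; exact: measurable_ip_rv. Qed.

Lemma integrable_norm2 : P.-integrable setT (fun w => (`|X w : H| ^+ 2)%:E).
Proof.
apply/integrableP; split; first exact/measurable_EFinP/measurable_norm2_rv.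
under eq_integral do rewrite abse_EFin ger0_norm ?sqr_ge0//.
by have := sqintX; rewrite /square_integrable unlock.
Qed.

(** Every integrand that occurs grows at most quadratically in [X], and
constants are integrable because [P] is finite. *)
Lemma integrable_dominated (f : Omega -> R) (c : R) :
  measurable_fun setT f -> (forall w, `|f w| <= c * (1 + `|X w : H| ^+ 2)) ->
  P.-integrable setT (fun w => (f w)%:E).
Proof.
move=> mf fc; apply: (@le_integrable _ _ _ P setT _ _
    (fun w => c%:E * (1%:E + (`|X w : H| ^+ 2)%:E))%E) => //.
- exact/measurable_EFinP.
- move=> w _; rewrite -EFinD -EFinM !abse_EFin lee_fin.
  exact: le_trans (fc w) (ler_norm _).
- apply: integrableZl => //; apply: integrableD => //.
    exact: finite_measure_integrable_cst.
  exact: integrable_norm2.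
Qed.

Lemma integrable_ip v : P.-integrable setT (fun w => (ip (X w) v)%:E).
Proof.
apply: (@integrable_dominated _ `|v|); first exact: measurable_ip_rv.
move=> w; apply: le_trans (cauchy_schwarz normE _ _) _; rewrite mulrC.
rewrite ler_wpM2l//; have := sqr_ge0 (`|X w : H| - 1); set y := `|_|.
by have : 0 <= y := normr_ge0 _; nra.
Qed.

Lemma integrable_ip_mul v v' :
  P.-integrable setT (fun w => (ip (X w) v * ip (X w) v')%:E).
Proof.
apply: (@integrable_dominated _ (`|v| * `|v'|)).
  by apply: measurable_funM; exact: measurable_ip_rv.
move=> w; rewrite normrM.
apply: le_trans (ler_pM _ _ (cauchy_schwarz normE _ v)
  (cauchy_schwarz normE _ v')) _ => //.
rewrite mulrACA mulrC ler_wpM2l ?mulr_ge0//.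
by rewrite -expr2 lerDr.
Qed.

Lemma KL_integrable j : P.-integrable setT (fun w => (eta j w)%:E).
Proof.
rewrite /eta /KL_coefficient; under eq_fun do rewrite EFinM.
by apply: integrableZl => //; exact: integrable_ip.
Qed.

Lemma KL_mul_integrable j l :
  P.-integrable setT (fun w => (eta j w * eta l w)%:E).
Proof.
rewrite /eta /KL_coefficient; under eq_fun do rewrite mulrACA EFinM.
by apply: integrableZl => //; exact: integrable_ip_mul.
Qed.

Lemma KL_centered j : (\int[P]_w (eta j w)%:E = 0)%E.
Proof.
rewrite /eta /KL_coefficient; under eq_integral do rewrite EFinM.
rewrite integralZl//; last exact: integrable_ip.
have := meanX (u j); rewrite unlock => ->.
by rewrite linear0l mule0.
Qed.

(** The covariance of [<X, u_j>] and [<X, u_l>] is [<Sigma u_j, u_l>]. *)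
Lemma KL_orthonormal j l :
  (\int[P]_w (eta j w * eta l w)%:E = ((j == l)%:R)%:E)%E.
Proof.
have [onb Su _ _] := specX.
rewrite /eta /KL_coefficient; under eq_integral do rewrite mulrACA EFinM.
rewrite integralZl//; last exact: integrable_ip_mul.
have := covX (u j) (u l); rewrite unlock => cov.
have -> : (\int[P]_w (ip (X w) (u j) * ip (X w) (u l))%:E =
           \int[P]_w (ip (tensor ip (X w) (X w) (u j)) (u l))%:E)%E.
  by apply: eq_integral => w _; rewrite ipZl.
rewrite cov Su ipZl (proj1 onb) -EFinM; congr (_%:E).
case: eqVneq => [<-|_]; last by rewrite !mulr0.
by rewrite mulr1 -invfM -expr2 sqr_sqrtr ?mulVf ?gt_eqF// ltW.
Qed.

Context (L : R).
Hypothesis L0 : 0 < L.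
Hypothesis subgX :
  (ereal_sup (range (fun j : nat => subgaussian_norm P (eta j))) <= L%:E)%E.

Let C := 4 * expR 1 * L ^+ 2.

Lemma KL_exp_square j : (\int[P]_w (expR (eta j w ^+ 2 / C))%:E <= 2%:E)%E.
Proof.
apply: subgaussian_exp_square => //; first exact: measurable_KL.
by apply: le_trans subgX; apply: ereal_sup_ubound; exists j.
Qed.

Lemma scale_gt0 : 0 < C.
Proof. by rewrite mulr_gt0 ?exprn_gt0// mulr_gt0 ?expR_gt0. Qed.

(** The average of the first [d] squared coefficients; subtracting [2] turns
the bound [2] on the exponential moment into one below [1], as needed for a
Chernoff bound. *)
Lemma trace_mgf_le d : (0 < d)%N ->
  (\int[P]_w (expR ((\sum_(j < d) eta j w ^+ 2) / (d%:R * C) - 2))%:E <=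
   (expR (- 1))%:E)%E.
Proof.
move=> d0; have dR : d%:R != 0 :> R by rewrite pnatr_eq0 -lt0n.
have wE w : expR ((\sum_(j < d) eta j w ^+ 2) / (d%:R * C) - 2) =
    expR (- 2) * expR (\sum_(0 <= j < d) d%:R^-1 * (eta j w ^+ 2 / C)).
  rewrite -expRD big_mkord addrC mulr_suml; congr expR; congr (_ + _).
  by apply: eq_bigr => j _; rewrite invfM mulrCA.
under eq_integral do rewrite wE.
rewrite integral_scale_nonneg ?expR_ge0//; last first.
  apply: measurableT_comp => //; apply: measurable_sum => j.
  apply: measurable_funM => //; apply: measurable_funM => //.
  by apply: measurable_funX; exact: measurable_KL.
apply: (@le_trans _ _ ((expR (- 2))%:E * 2%:E)%E).
  rewrite lee_wpmul2l ?lee_fin ?expR_ge0//.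
  apply: weighted_squares_exp_le.
  - by move=> j; exact: measurable_KL.
  - exact: KL_exp_square.
  - by move=> _; rewrite invr_ge0.
  - by rewrite big_mkord sumr_const card_ord -[_ *+ d]mulr_natl divff.
by rewrite -EFinM lee_fin expRN2_double_le.
Qed.

Context (d : nat) (tau : R).
Hypothesis tau0 : 0 < tau.
Hypothesis tau_le : forall N, \sum_(d <= j < N) lam j <= tau.

Let tail w := `|(X w : H) - projection_le ip u d (X w : H)| ^+ 2.

Lemma measurable_tail : measurable_fun setT tail.
Proof.
have [onb _ _ _] := specX.
exact: (measurableT_comp (residual_borel_measurable d normE onb)).
Qed.

(** The tail is [sum_(j >= d) lam_j eta_j^2], to which
[weighted_squares_exp_le] applies with weights [lam_j / tau]; finite sums
first, then monotone convergence. *)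
Lemma tail_exp_le : (\int[P]_w (expR (tail w / (C * tau)))%:E <= 2%:E)%E.
Proof.
have [onb _ _ _] := specX.
have Ctau : 0 < C * tau by rewrite mulr_gt0// scale_gt0.
pose f N w := expR ((\sum_(d <= k < N) ip (u k) (X w) ^+ 2) / (C * tau)).
have fE N w : f N w = expR (\sum_(d <= j < N) lam j / tau * (eta j w ^+ 2 / C)).
  rewrite /f mulr_suml; congr expR; apply: eq_bigr => j _.
  rewrite /eta /KL_coefficient exprMn exprVn sqr_sqrtr ?ltW// ipC.
  by field; rewrite !gt_eqF// scale_gt0.
have cvgf w : (f N w)%:E @[N --> \oo] --> (expR (tail w / (C * tau)))%:E.
  apply: cvg_EFin; first exact: nearW.
  apply: (@continuous_cvg _ _ _ _ _ _ (@expR R)); first exact: continuous_expR.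
  by apply: cvgM; [exact: residual_sum_cvg|exact: cvg_cst].
have mf N : measurable_fun setT (f N).
  apply: measurableT_comp => //; apply: measurable_funM => //.
  apply: measurable_sum => k; apply: measurable_funX.
  under eq_fun do rewrite ipC; exact: measurable_ip_rv.
have ndf w m n : (m <= n)%N -> f m w <= f n w.
  move=> mn; rewrite ler_expR ler_wpM2r// ?invr_ge0 ?(ltW Ctau)//.
  have [dm|md] := leqP d m; last first.
    by rewrite big_geq ?(ltnW md)// sumr_ge0// => k _; exact: sqr_ge0.
  rewrite (@big_cat_nat _ _ _ m d n)//= lerDl sumr_ge0// => k _.
  exact: sqr_ge0.
have -> : (\int[P]_w (expR (tail w / (C * tau)))%:E =
           \int[P]_w limn (fun N => (f N w)%:E))%E.
  by apply: eq_integral => w _; apply/esym/cvg_lim.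
rewrite monotone_convergence//.
- have bound N : (\int[P]_w (f N w)%:E <= 2%:E)%E.
    under eq_integral do rewrite fE.
    apply: weighted_squares_exp_le.
    + by move=> j; exact: measurable_KL.
    + exact: KL_exp_square.
    + by move=> j; rewrite divr_ge0 ?ltW.
    + by rewrite -mulr_suml ler_pdivrMr// mul1r.
  apply: lime_le; last by apply: nearW.
  apply: ereal_nondecreasing_is_cvgn => m n mn.
  apply: le_integral_nonneg => // w; [exact: expR_ge0|exact: ndf].
- by move=> N; exact/measurable_EFinP.
- by move=> N w _; rewrite lee_fin expR_ge0.
- by move=> w _ m n mn; rewrite lee_fin ndf.
Qed.

Lemma tail_mgf_le :
  (\int[P]_w (expR (tail w / (C * tau) - 2))%:E <= (expR (- 1))%:E)%E.
Proof.
have mt := measurable_tail.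
under eq_integral do rewrite addrC expRD.
rewrite integral_scale_nonneg ?expR_ge0//; last first.
  by apply: measurableT_comp => //; exact: measurable_funM.
apply: (@le_trans _ _ ((expR (- 2))%:E * 2%:E)%E).
  by rewrite lee_wpmul2l ?lee_fin ?expR_ge0// tail_exp_le.
by rewrite -EFinM lee_fin expRN2_double_le.
Qed.

(** From [y <= exp y] and [tail_exp_le]. *)
Lemma tail_mean_le : (\int[P]_w (tail w)%:E <= (2 * (C * tau))%:E)%E.
Proof.
have Ctau : 0 < C * tau by rewrite mulr_gt0// scale_gt0.
have mt := measurable_tail.
have mexp : measurable_fun setT (fun w => expR (tail w / (C * tau))).
  by apply: measurableT_comp => //; exact: measurable_funM.
apply: (@le_trans _ _ (\int[P]_w (C * tau * expR (tail w / (C * tau)))%:E)%E).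
  apply: le_integral_nonneg => //.
  - exact: measurable_funM.
  - by move=> w; exact: sqr_ge0.
  - move=> w; rewrite mulrC -ler_pdivrMr//.
    by have := expR_ge1Dx (tail w / (C * tau)); lra.
rewrite integral_scale_nonneg ?(ltW Ctau)//.
rewrite [leRHS](_ : _ = (C * tau)%:E * 2%:E)%E; last by rewrite -EFinM mulrC.
by rewrite lee_wpmul2l ?lee_fin ?(ltW Ctau)// tail_exp_le.
Qed.

End KarhunenLoeve.

(** * Union bound *)

Section UnionBound.
Context d (T : measurableType d) (R : realType) (P : probability T R).

Lemma union_bound (I : finType) (N : {set I}) (A : I -> set T) (delta : R) :
  (forall i, measurable (A i)) ->
  (forall i, i \in N -> (P (A i) <= delta%:E)%E) ->
  (P (\big[setU/set0]_(i in N) A i) <= (#|N|%:R * delta)%:E)%E.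
Proof.
move=> mA PA.
have le_sum : (P (\big[setU/set0]_(i in N) A i) <= \sum_(i in N) P (A i))%E.
  suff [] : measurable (\big[setU/set0]_(i in N) A i) /\
      (P (\big[setU/set0]_(i in N) A i) <= \sum_(i in N) P (A i))%E by [].
  apply: (big_ind2 (fun B (b : \bar R) => measurable B /\ (P B <= b)%E)) => //.
  - by split=> //; rewrite measure0.
  - move=> B b B' b' [mB PB] [mB' PB']; split; first exact: measurableU.
    by apply: le_trans (measureU2 _ _ _) _ => //; exact: leeD.
apply: le_trans le_sum _; apply: (@le_trans _ _ (\sum_(i in N) delta%:E)%E).
  by apply: lee_sum => i iN; exact: PA.
by rewrite sumEFin lee_fin sumr_const mulr_natl.
Qed.

Lemma probability_at_least_complement (p : R) (A B : set T) :
  measurable B -> (P B <= p%:E)%E -> ~` B `<=` A ->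
  probability_at_least P (1 - p) A.
Proof.
move=> mB PB BA; exists (~` B); split=> //; first exact: measurableC.
by rewrite probability_setC// EFinB leeB.
Qed.

(** The cardinality of the net is at most [exp ((S + 2) m)], and [(S + 2) m]
is at most half of [k n]. Since [m >= 1] the hypothesis also forces [k n >=
8], which absorbs the number of events. *)
Lemma failure_probability_le (k k0 : R) (S m n : nat) :
  0 < k -> k <= 1 -> k <= k0 -> (0 < m)%N ->
  m%:R <= k / (2 * (S%:R + 4)) * n%:R ->
  expR (- n%:R) + expR (- n%:R) + 2 ^+ (S * m) * 4 ^+ m * expR (- k0 * n%:R) <=
  expR (- (k / 4) * n%:R).
Proof.
move=> k_gt0 k1 kk0 m0 mn.
have S0 : 0 <= S%:R :> R by [].
have n0 : 0 <= n%:R :> R by [].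
have mR : 1 <= m%:R :> R by rewrite ler1n.
have {}mn : 2 * (S%:R + 4) * m%:R <= k * n%:R.
  move: mn; rewrite mulrAC ler_pdivlMr; last by lra.
  by rewrite mulrC.
have e2 : 2 <= expR 1 :> R by have := expR_ge1Dx (1 : R); lra.
have pow2 p : 2 ^+ p <= expR p%:R :> R.
  rewrite -[p%:R]mul1r expRM_natr; by apply: lerXn2r; rewrite ?nnegrE ?expR_ge0.
have net : 2 ^+ (S * m) * 4 ^+ m * expR (- k0 * n%:R) <= expR (- (k / 2) * n%:R).
  have -> : 2 ^+ (S * m) * 4 ^+ m = 2 ^+ (S * m + 2 * m) :> R.
    by rewrite (_ : 4 = 2 ^+ 2) -?exprM -?exprD//; ring.
  apply: le_trans (ler_wpM2r (expR_ge0 _) (pow2 _)) _.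
  rewrite -expRD ler_expR natrD !natrM; nra.
have triv : expR (- n%:R) <= expR (- (k / 2) * n%:R) by rewrite ler_expR; nra.
have half : expR (- (k / 2) * n%:R) =
            expR (- (k / 4) * n%:R) * expR (- (k / 4) * n%:R).
  by rewrite -expRD; congr expR; field.
have e3 : 3 * expR (- (k / 4) * n%:R) <= 1.
  rewrite mulNr expRN ler_pdivrMr ?expR_gt0// mul1r.
  by apply: le_trans (expR_ge1Dx _); nra.
have := ler_wpM2r (expR_ge0 (- (k / 4) * n%:R)) e3.
by rewrite half in net triv; lra.
Qed.

End UnionBound.

(** * Risk of a fixed projection *)

Section Reconstruction.
Context (R : realType) (H : completeNormedModType R) (ip : {dot H for idfun}).
Context (dT : measure_display) (Omega : measurableType dT)
  (P : probability Omega R) (X : {RV P >-> borel H}) (Sigma : H -> H)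
  (lam : nat -> R) (u : nat -> H).
Hypothesis normE : induces_norm ip.
Hypothesis sqintX : square_integrable P (X : Omega -> H).
Hypothesis covX : is_covariance P ip X Sigma.
Hypothesis specX : spectral_decomposition ip Sigma lam u.
Hypothesis lam0 : forall j, 0 < lam j.

(** A weighted Gram matrix of the residuals. *)
Let cross (v : nat -> H) m (j l : 'I_m) : R :=
  Num.sqrt (lam j) * Num.sqrt (lam l) *
  ip (u j - projection_le ip v m (u j)) (u l - projection_le ip v m (u l)).

(** A quadratic form in the Karhunen-Loeve coefficients, so that its
expectation follows from their orthonormality. *)
Lemma leading_part_residual (v : nat -> H) m w :
  `|projection_le ip u m (X w) -
      projection_le ip v m (projection_le ip u m (X w))| ^+ 2 =
  \sum_(j < m) \sum_(l < m) cross v j l *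
     (KL_coefficient ip X lam u j w * KL_coefficient ip X lam u l w).
Proof.
have -> : projection_le ip u m (X w) -
    projection_le ip v m (projection_le ip u m (X w)) =
    \sum_(j < m) ip (u j) (X w) *: (u j - projection_le ip v m (u j)).
  under [RHS]eq_bigr do rewrite scalerBr.
  rewrite sumrB; congr (_ - _); rewrite [LHS]/projection_le.
  under [RHS]eq_bigr do rewrite /projection_le scaler_sumr.
  rewrite exchange_big/=; apply: eq_bigr => k _.
  rewrite /tensor ip_sumr scaler_suml; apply: eq_bigr => j _.
  by rewrite ipZr scalerA.
rewrite -normE ip_suml; apply: eq_bigr => j _.
rewrite ip_sumr; apply: eq_bigr => l _.
rewrite ipZl ipZr /cross /KL_coefficient (ipC ip (u j)) (ipC ip (u l) (X w)).
have sq0 i : Num.sqrt (lam i) != 0 by rewrite gt_eqF// sqrtr_gt0.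
by field; rewrite !sq0.
Qed.

Lemma leading_part_error (v : nat -> H) m :
  (\int[P]_w (`|projection_le ip u m (X w) -
      projection_le ip v m (projection_le ip u m (X w))| ^+ 2)%:E =
   (\sum_(j < m) lam j * `|u j - projection_le ip v m (u j)| ^+ 2)%:E)%E.
Proof.
under eq_integral do rewrite leading_part_residual.
rewrite (orthonormal_second_moment (KL_mul_integrable lam u normE sqintX)
  (KL_orthonormal normE sqintX covX specX lam0)); congr (_%:E).
by apply: eq_bigr => j _; rewrite /cross -expr2 sqr_sqrtr ?normE// ltW.
Qed.

(** The residual of [X] is split along the projection of [X] onto the first
[m] eigenvectors. *)
Lemma reconstruction_error_le (v : nat -> H) m (M1 M2 : R) :
  orthonormal_basis ip v ->
  \sum_(j < m) lam j * `|u j - projection_le ip v m (u j)| ^+ 2 <= M1 ->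
  (\int[P]_w (`|(X w : H) - projection_le ip u m (X w : H)| ^+ 2)%:E <= M2%:E)%E ->
  (reconstruction_error P (X : Omega -> H) (projection_le ip v m) <=
   (2 * M1 + 2 * M2)%:E)%E.
Proof.
move=> onbv le1 le2; have [onbu _ _ _] := specX.
rewrite /reconstruction_error unlock.
have mtail := measurable_tail X normE specX m.
pose lead w := `|projection_le ip u m (X w) -
  projection_le ip v m (projection_le ip u m (X w))| ^+ 2.
have mlead : measurable_fun setT lead.
  rewrite /lead; under eq_fun do rewrite leading_part_residual.
  apply: measurable_sum => j; apply: measurable_sum => l.
  by apply: measurable_funM => //; apply: measurable_funM; exact: measurable_KL.
have mres : measurable_fun setT
    (fun w => `|(X w : H) - projection_le ip v m (X w : H)| ^+ 2).
  exact: (measurableT_comp (residual_borel_measurable m normE onbv)).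
apply: (@le_trans _ _ (\int[P]_w (2 * lead w +
    2 * `|(X w : H) - projection_le ip u m (X w : H)| ^+ 2)%:E)%E).
  apply: le_integral_nonneg => //.
  - by apply: measurable_funD; exact: measurable_funM.
  - move=> w; set p := projection_le ip u m (X w).
    have := residual_add_le normE v m p (X w - p).
    rewrite [p + _]addrC subrK => /le_trans; apply; rewrite lerD2l ler_pM2l//.
    exact: (residual_norm_le normE onbv).
under eq_integral do rewrite EFinD.
rewrite ge0_integralD//; last 3 first.
- by move=> w _; rewrite lee_fin mulr_ge0 ?sqr_ge0.
- by apply/measurable_EFinP; exact: measurable_funM.
- by apply/measurable_EFinP; exact: measurable_funM.
have le1' : (\int[P]_w (lead w)%:E <= M1%:E)%E by rewrite leading_part_error lee_fin.
rewrite (integral_scale_nonneg _ (f := lead))//; last by move=> w; exact: sqr_ge0.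
rewrite integral_scale_nonneg//.
rewrite [leRHS](_ : _ = 2%:E * M1%:E + 2%:E * M2%:E)%E//.
by apply: leeD; apply: lee_wpmul2l.
Qed.

End Reconstruction.

(** * The high-probability event *)

Section HighProbability.
Context (R : realType) (H : completeNormedModType R) (ip : {dot H for idfun}).
Context (dT : measure_display) (Omega : measurableType dT)
  (P : probability Omega R) (X : {RV P >-> borel H}) (Sigma : H -> H)
  (lam : nat -> R) (u : nat -> H) (L : R).
Hypothesis normE : induces_norm ip.
Hypothesis meanX : has_mean P ip X 0.
Hypothesis sqintX : square_integrable P (X : Omega -> H).
Hypothesis covX : is_covariance P ip X Sigma.
Hypothesis specX : spectral_decomposition ip Sigma lam u.
Hypothesis lam0 : forall j, 0 < lam j.
Hypothesis L0 : 0 < L.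
Hypothesis indeta : mutually_independent P (KL_coefficient ip X lam u).
Hypothesis subgX : (ereal_sup (range (fun j : nat =>
  subgaussian_norm P (KL_coefficient ip X lam u j))) <= L%:E)%E.
Context (n : nat) (Xs : 'I_n -> {RV P >-> borel H}).
Hypothesis n0 : (0 < n)%N.
Hypothesis indX : mutually_independent P (fun i => Xs i : Omega -> borel H).
Hypothesis distX : forall i, identically_distributed (Xs i) X.

Local Notation coef j x := ((Num.sqrt (lam j))^-1 * ip (x : H) (u j)).

Let C := 4 * expR 1 * L ^+ 2.
Let C0 : 0 < C. Proof. exact: scale_gt0. Qed.

(** The value of [t] required by [linear_form_lower_mgf]. *)
Let t := (2 ^+ 9 * expR 1 * (8 * C))^-1.

Lemma rate_gt0 : 0 < t.
Proof. by rewrite invr_gt0 !mulr_gt0// ?exprn_gt0 ?expR_gt0. Qed.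

Lemma coef_measurable j : measurable_fun setT (fun x : borel H => coef j x : R).
Proof. by apply: measurable_funM => //; exact: ip_borel_measurable. Qed.

Lemma empirical_trace_deviation d : (0 < d)%N ->
  (P [set w | (0 <= \sum_(i < n) ((\sum_(j < d) coef j (Xs i w) ^+ 2) /
      (d%:R * C) - 2))%R] <= (expR (- n%:R))%:E)%E.
Proof.
move=> d0.
have := chernoff_iid (f := fun x : borel H =>
  (\sum_(j < d) coef j x ^+ 2) / (d%:R * C) - 2) (k := 1) indX distX.
rewrite mulN1r; apply; last by have := trace_mgf_le normE L0 subgX d0.
apply: measurable_funB => //; apply: measurable_funM => //.
by apply: measurable_sum => j; apply: measurable_funX; exact: coef_measurable.
Qed.

Lemma empirical_tail_deviation d tau : 0 < tau ->
  (forall N, \sum_(d <= j < N) lam j <= tau) ->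
  (P [set w | (0 <= \sum_(i < n) (`|(Xs i w : H) -
      projection_le ip u d (Xs i w : H)| ^+ 2 / (C * tau) - 2))%R] <=
   (expR (- n%:R))%:E)%E.
Proof.
move=> tau0 tau_le; have [onb _ _ _] := specX.
have := chernoff_iid (f := fun x : borel H =>
  `|(x : H) - projection_le ip u d (x : H)| ^+ 2 / (C * tau) - 2) (k := 1) indX distX.
rewrite mulN1r; apply; last by have := tail_mgf_le normE specX lam0 L0 subgX tau0 tau_le.
apply: measurable_funB => //; apply: measurable_funM => //.
exact: residual_borel_measurable.
Qed.

(** The vector [v] is normalised to the length required by
[linear_form_lower_mgf]; unscaled, the event says that the form at [v] is at
most half of its mean. *)
Lemma empirical_form_deviation d (v : 'I_d -> R) : 0 < \sum_(j < d) v j ^+ 2 ->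
  (P [set w | (0 <= \sum_(i < n) t * ((4 * C)^-1 -
     (\sum_(j < d) v j / Num.sqrt (2 * C * \sum_(j < d) v j ^+ 2) *
        coef j (Xs i w)) ^+ 2))%R] <= (expR (- (t / (8 * C)) * n%:R))%:E)%E.
Proof.
move=> s0; set s := \sum_(j < d) v j ^+ 2 in s0 *.
have D0 : 0 < 2 * C * s by rewrite !mulr_gt0.
pose a j := v j / Num.sqrt (2 * C * s).
have a1 : 2 * C * (\sum_(j < d) a j ^+ 2) = 1.
  rewrite /a; under eq_bigr do rewrite exprMn exprVn sqr_sqrtr ?(ltW D0)//.
  by rewrite -mulr_suml -/s mulrA mulfV// gt_eqF.
have := chernoff_iid (f := fun x : borel H =>
  t * ((4 * C)^-1 - (\sum_(j < d) a j * coef j x) ^+ 2)) (k := t / (8 * C))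
  indX distX.
apply.
  apply: measurable_funM => //; apply: measurable_funB => //.
  apply: measurable_funX; apply: measurable_sum => j.
  by apply: measurable_funM => //; exact: coef_measurable.
have tC : t * (2 ^+ 9 * expR 1) = (8 * C)^-1.
  have A0 : 2 ^+ 9 * expR 1 != 0 :> R.
    by rewrite gt_eqF// mulr_gt0 ?exprn_gt0 ?expR_gt0.
  by rewrite /t invrM ?unitfE ?(gt_eqF C0)// ?mulf_neq0 ?gt_eqF// mulrVK ?unitfE.
have := linear_form_lower_mgf C0 (measurable_KL X lam u normE) indeta
  (KL_integrable lam u normE sqintX) (KL_centered lam u normE meanX sqintX)
  (KL_exp_square normE L0 subgX) (ltW rate_gt0) tC a1.
apply; exact: (linear_form_second_moment (KL_mul_integrable lam u normE sqintX)
  (KL_orthonormal normE sqintX covX specX lam0)).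
Qed.

Context (lamhat : Omega -> nat -> R) (uhat : Omega -> nat -> H).
Hypothesis spechat : forall w, spectral_decomposition ip
  (sample_covariance ip (fun i => Xs i) w) (lamhat w) (uhat w).

(** Outside of the three kinds of bad events, [quadratic_form_lower] provides
the hypothesis of [leading_error_le], and the empirical tail provides its
right-hand side. *)
Lemma pca_risk_high_probability d tau (S : nat) (k : R) :
  (0 < d)%N -> 0 < tau -> (forall N, \sum_(d <= j < N) lam j <= tau) ->
  4 * (2 * C) + 10 <= S%:R -> 0 < k -> k <= 1 -> k <= t / (8 * C) ->
  d%:R <= k / (2 * (S%:R + 4)) * n%:R ->
  probability_at_least P (1 - expR (- (k / 4) * n%:R))
    [set w | (reconstruction_error P (X : Omega -> H)
                (projection_le ip (uhat w) d) <= (132 * C * tau)%:E)%E].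
Proof.
move=> d0 tau0 tau_le SC k0 k1 kt dn.
have [onbu _ _ _] := specX.
have nR : 0 < n%:R :> R by rewrite ltr0n.
have dR : 0 < d%:R :> R by rewrite ltr0n.
pose B1 := [set w | 0 <= \sum_(i < n) ((\sum_(j < d) coef j (Xs i w) ^+ 2) /
      (d%:R * C) - 2)].
pose B2 := [set w | 0 <= \sum_(i < n) (`|(Xs i w : H) -
      projection_le ip u d (Xs i w : H)| ^+ 2 / (C * tau) - 2)].
pose B3 (f : lattice_point d (S * d).+1) :=
  [set w | 0 <= \sum_(i < n) t * ((4 * C)^-1 -
     (\sum_(j < d) lattice_vec R f j /
        Num.sqrt (2 * C * \sum_(j < d) lattice_vec R f j ^+ 2) *
        coef j (Xs i w)) ^+ 2)].
pose N := [set f in lattice_net d (S * d).+1 (S * d) |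
  0 < \sum_(j < d) lattice_vec R f j ^+ 2].
have mB1 : measurable B1.
  apply: (measurable_sum_ge0 Xs (f := fun x : borel H =>
    (\sum_(j < d) coef j x ^+ 2) / (d%:R * C) - 2)).
  apply: measurable_funB => //; apply: measurable_funM => //.
  by apply: measurable_sum => j; apply: measurable_funX; exact: coef_measurable.
have mB2 : measurable B2.
  apply: (measurable_sum_ge0 Xs (f := fun x : borel H =>
    `|(x : H) - projection_le ip u d (x : H)| ^+ 2 / (C * tau) - 2)).
  apply: measurable_funB => //; apply: measurable_funM => //.
  exact: residual_borel_measurable.
have mB3 f : measurable (B3 f).
  apply: (measurable_sum_ge0 Xs (f := fun x : borel H => t * ((4 * C)^-1 -
     (\sum_(j < d) lattice_vec R f j /
        Num.sqrt (2 * C * \sum_(j < d) lattice_vec R f j ^+ 2) * coef j x) ^+ 2))).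
  apply: measurable_funM => //; apply: measurable_funB => //.
  apply: measurable_funX; apply: measurable_sum => j.
  by apply: measurable_funM => //; exact: coef_measurable.
have mB3N : measurable (\big[setU/set0]_(f in N) B3 f).
  by apply: bigsetU_measurable => f _.
apply: (@probability_at_least_complement _ _ _ _ _ _
    (B1 `|` B2 `|` \big[setU/set0]_(f in N) B3 f)).
- by apply: measurableU => //; exact: measurableU.
- apply: le_trans (measureU2 _ _ _) _ => //; first exact: measurableU.
  apply: (@le_trans _ _ (((expR (- n%:R))%:E + (expR (- n%:R))%:E) +
    (2 ^+ (S * d) * 4 ^+ d * expR (- (t / (8 * C)) * n%:R))%:E)%E).
    apply: leeD.
      apply: le_trans (measureU2 _ _ _) _ => //; apply: leeD.
        exact: empirical_trace_deviation.
      exact: empirical_tail_deviation.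
    apply: (@le_trans _ _ (#|N|%:R * expR (- (t / (8 * C)) * n%:R))%:E).
      apply: union_bound => // f; rewrite inE => /andP[_ s0].
      exact: empirical_form_deviation.
    rewrite lee_fin ler_wpM2r ?expR_ge0//.
    apply: le_trans (card_lattice_net R d (S * d).+1 (S * d)).
    rewrite ler_nat; apply: subset_leq_card.
    by apply/fintype.subsetP => f; rewrite inE => /andP[].
  by rewrite -!EFinD lee_fin; exact: failure_probability_le.
move=> w; rewrite !setCU => -[[/= nB1 nB2] nB3].
have trace_le : \sum_(i < n) \sum_(j < d) coef j (Xs i w) ^+ 2 <=
    n%:R * d%:R * (2 * C).
  move/negP: nB1; rewrite -ltNge sumrB -mulr_suml sumr_const card_ord.
  rewrite subr_lt0 ltr_pdivrMr ?mulr_gt0// -[2 *+ n]mulr_natl => /ltW /le_trans; apply.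
  by rewrite le_eqVlt; apply/orP; left; apply/eqP; ring.
have tail_le : n%:R^-1 * \sum_(i < n) `|(Xs i w : H) -
    projection_le ip u d (Xs i w : H)| ^+ 2 <= 2 * (C * tau).
  move/negP: nB2; rewrite -ltNge sumrB -mulr_suml sumr_const card_ord.
  rewrite subr_lt0 ltr_pdivrMr ?mulr_gt0// -[2 *+ n]mulr_natl => /ltW le2.
  by rewrite ler_pdivrMl//; lra.
have lower (a : 'I_d -> R) : n%:R * (\sum_(j < d) a j ^+ 2) / 8 <=
    \sum_(i < n) (\sum_(j < d) a j * coef j (Xs i w)) ^+ 2.
  apply: (quadratic_form_lower (eta := fun i j => coef j (Xs i w))
    (B := 2 * C) (S := S)) => //; first by rewrite mulr_ge0// ltW.
  move=> f fN s0; rewrite leNgt; apply/negP => small; apply: nB3.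
  have fN' : f \in N by rewrite inE fN.
  rewrite (bigD1 f)//=; left; rewrite /B3 /=.
  set s := \sum_(j < d) lattice_vec R f j ^+ 2 in s0 small *.
  have D0 : 0 < 2 * C * s by rewrite !mulr_gt0.
  rewrite -mulr_sumr mulr_ge0// ?(ltW rate_gt0)// sumrB sumr_const card_ord.
  rewrite subr_ge0.
  have -> : \sum_(i < n) (\sum_(j < d) lattice_vec R f j / Num.sqrt (2 * C * s) *
      coef j (Xs i w)) ^+ 2 =
      (2 * C * s)^-1 * \sum_(i < n)
        (\sum_(j < d) lattice_vec R f j * coef j (Xs i w)) ^+ 2.
    rewrite [RHS]mulr_sumr; apply: eq_bigr => i _.
    rewrite -{2}(sqr_sqrtr (ltW D0)) -exprVn -exprMn; congr (_ ^+ 2).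
    rewrite [RHS]mulr_sumr.
    by apply: eq_bigr => j _; rewrite mulrAC mulrC.
  rewrite ler_pdivrMl// (le_trans (ltW small))// le_eqVlt; apply/orP; left.
  by apply/eqP; rewrite -[in RHS]mulr_natl; field; rewrite gt_eqF.
have lead := leading_error_le normE (spechat w) n0 onbu lam0 lower.
have tail_mean := tail_mean_le normE specX lam0 L0 subgX tau0 tau_le.
have [onbh _ _ _] := spechat w.
rewrite /=.
apply: le_trans (reconstruction_error_le normE sqintX covX specX lam0 onbh
  lead tail_mean) _.
(* The two summands are [2 * 32 * (2 * (C * tau))] and [2 * (2 * (C * tau))].
*)
rewrite -/C lee_fin; move: tail_le; set q := n%:R^-1 * _ => tail_le.
by set Ct := C * tau in tail_le *; rewrite -mulrA -/Ct; lra.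
Qed.

End HighProbability.

Theorem corollary3 (R : realType) (L alpha K : R)
    (hL : 0 < L) (halpha : 1 < alpha) (hK : 0 < K) :
  exists c1 c2 C1 : R, [/\ 0 < c1, 0 < c2, 0 < C1 &
    forall (H : completeNormedModType R) (ip : {dot H for idfun})
      (dT : measure_display) (Omega : measurableType dT)
      (P : probability Omega R)
      (X : {RV P >-> borel H}) (Sigma : H -> H)
      (lam : nat -> R) (u : nat -> H),
    induces_norm ip ->
    has_mean P ip X 0 ->
    square_integrable P (X : Omega -> H) ->
    is_covariance P ip X Sigma ->
    spectral_decomposition ip Sigma lam u ->
    (forall j, 0 < lam j) ->
    mutually_independent P (KL_coefficient ip X lam u) ->
    (ereal_sup (range (fun j : nat =>
       subgaussian_norm P (KL_coefficient ip X lam u j))) <= L%:E)%E ->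
    (forall j : nat, lam j <= K * j.+1%:R `^ (- alpha)) ->
    forall (n : nat) (Xs : 'I_n -> {RV P >-> borel H})
      (lamhat : Omega -> nat -> R) (uhat : Omega -> nat -> H),
    (0 < n)%N ->
    mutually_independent P (fun i => Xs i : Omega -> borel H) ->
    (forall i, identically_distributed (Xs i) X) ->
    (forall w, spectral_decomposition ip (sample_covariance ip (fun i => Xs i) w)
                 (lamhat w) (uhat w)) ->
    forall d : nat, (1 <= d)%N -> d%:R <= c1 * n%:R ->
    probability_at_least P (1 - expR (- c2 * n%:R))
      [set w | (reconstruction_error P (X : Omega -> H)
                  (projection_le ip (uhat w) d)
                <= (C1 * d%:R `^ (1 - alpha))%:E)%E]].
Proof.
have e0 : 0 < expR 1 :> R by exact: expR_gt0.
pose C := 4 * expR 1 * L ^+ 2.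
have C0 : 0 < C by exact: scale_gt0.
have a0 : 0 < alpha - 1 by rewrite subr_gt0.
pose t := (2 ^+ 9 * expR 1 * (8 * C))^-1.
have t0 : 0 < t by exact: rate_gt0.
(* The rate is capped by [1] to cover all three kinds of events. *)
pose k := Num.min 1 (t / (8 * C)).
have k0 : 0 < k by rewrite lt_min ltr01/= divr_gt0// mulr_gt0.
have k1 : k <= 1 by rewrite ge_min lexx.
have kt : k <= t / (8 * C) by rewrite ge_min lexx orbT.
pose S := (Num.truncn (4 * (2 * C) + 10)).+1.
have SC : 4 * (2 * C) + 10 <= S%:R by apply/ltW/truncnS_gt.
have S4 : 0 < 2 * (S%:R + 4) :> R by rewrite mulr_gt0// ltr_wpDl.
exists (k / (2 * (S%:R + 4))), (k / 4), (132 * C * (K / (alpha - 1))).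
split.
- exact: divr_gt0.
- exact: divr_gt0.
- by rewrite mulr_gt0 ?divr_gt0// mulr_gt0.
move=> H ip dT Omega P X Sigma lam u normE meanX sqintX covX specX lam0 indeta
  subgX lam_le n Xs lamhat uhat n0 indX distX spechat d d0 dn.
pose tau := K * (d%:R `^ (1 - alpha) / (alpha - 1)).
have tau0 : 0 < tau.
  by rewrite mulr_gt0// divr_gt0// powR_gt0// ltr0n.
have tau_le N : \sum_(d <= j < N) lam j <= tau.
  apply: (@le_trans _ _ (K * \sum_(d <= j < N) j.+1%:R `^ (- alpha))).
    by rewrite mulr_sumr; apply: ler_sum => j _; exact: lam_le.
  by rewrite ler_wpM2l ?(ltW hK)// sum_powR_tail_le.
have := pca_risk_high_probability normE meanX sqintX covX specX lam0 hL indeta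
  subgX n0 indX distX spechat d0 tau0 tau_le SC k0 k1 kt dn.
rewrite (_ : 132 * C * tau = 132 * C * (K / (alpha - 1)) * d%:R `^ (1 - alpha))//.
by rewrite /tau; ring.
Qed.
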